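(* Let $d\ge2$, $e\in\mathbb{S}^d$ and $a\in(0,\pi/2)$. If $K\in\overline{\mathcal{K}}^d_e$ satisfies $\Sigma_e(K)\ge a$, then $$\widetilde U_e(K)\ge\widetilde U_e(B_s(e,a))=\sigma_d^\circ(B_s(e,2a)).$$ Moreover, there is a constant $c(a,d)$ with $$c(a,d)\ge(2\pi)^{-2d}\,a^{-1}\left(\min\left\{a,\tfrac\pi2-a\right\}\right)^{d-1}$$ such that for all $\varepsilon\in(0,1]$ and all $K\in\overline{\mathcal{K}}^d_e$ with $\Sigma_e(K)\ge a$ and $\vartheta_e(K)\ge\varepsilon$, $$\widetilde U_e(K)\ge\left(1+c(a,d)\,\varepsilon^{\frac{d+1}{2}}\right)\widetilde U_e(B_s(e,a)).$$
   Context: $\mathbb{S}^d$ is the unit sphere in $\mathbb{R}^{d+1}$ ($d\ge2$), $\sigma_d^\circ$ its normalized (probability) spherical Lebesgue measure, $B_s(x,r)$ the closed geodesic ball with centre $x$ and radius $r\le\pi$. A spherically convex body is the intersection of $\mathbb{S}^d$ with a closed convex cone in $\mathbb{R}^{d+1}$ that is not a linear subspace; $\overline{\mathcal{K}}^d_e$ is the set of spherically convex bodies $K$ with $e\in K\subset B_s(e,\pi/2)$. For $K\in\overline{\mathcal{K}}^d_e$: $\widetilde U_e(K)=\int_{\mathbb{S}^d}\mathbf 1\{(x-e)^\perp\cap K\neq\emptyset\}\,\sigma_d^\circ(dx)$; $\Sigma_e(K)=r_e(K)=\max\{r\ge0:B_s(e,r)\subset K\}$; $R_e(K)=\min\{r\ge0:K\subset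 B_s(e,r)\}$; $\vartheta_e(K)=R_e(K)-r_e(K)$. *)

(* Defs.v *)
From HB Require Import structures.
From mathcomp Require Import all_boot all_order all_algebra.
From mathcomp Require Import all_classical all_reals all_analysis.
From mathcomp Require Import measurable_realfun ring lra.

Set Implicit Arguments.
Unset Strict Implicit.
Unset Printing Implicit Defensive.

Import Order.TTheory GRing.Theory Num.Theory.
Import numFieldNormedType.Exports.

Local Open Scope classical_set_scope.
Local Open Scope ring_scope.

(* The sigma-algebra on row vectors is the one generated by the coordinate
   maps, i.e. the Borel sigma-algebra of R^n; it mirrors the library's instance
   on [n.-tuple T]. *)
Definition rV_display : measure_display.
Proof. exact: default_measure_display. Qed.

Section measurable_rV.
Context (R : realType) (n : nat).

Definition rV_coord (i : 'I_n) (x : 'rV[R]_n) : measurableTypeR R := x ord0 i.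

Let rV_set0 : g_sigma_preimage rV_coord set0.
Proof. exact: sigma_algebra0. Qed.

Let rV_setC A : g_sigma_preimage rV_coord A -> g_sigma_preimage rV_coord (~` A).
Proof. exact: sigma_algebraC. Qed.

Let rV_bigcup (F : (set 'rV[R]_n)^nat) :
  (forall i, g_sigma_preimage rV_coord (F i)) ->
  g_sigma_preimage rV_coord (\bigcup_i F i).
Proof. exact: sigma_algebra_bigcup. Qed.

HB.instance Definition _ := @isMeasurable.Build rV_display
  'rV[R]_n (g_sigma_preimage rV_coord) rV_set0 rV_setC rV_bigcup.

Lemma measurable_rV_coord (i : 'I_n) :
  measurable_fun [set: 'rV[R]_n] (rV_coord i).
Proof.
move=> _ Y mY; rewrite setTI; apply: sub_sigma_algebra => /=.
rewrite -bigcup_seq/=; exists i => /=; first by rewrite mem_index_enum.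
by exists Y => //; rewrite setTI.
Qed.

Lemma measurable_fun_rVP d1 (T1 : measurableType d1) (f : T1 -> 'rV[R]_n) :
  (forall i, measurable_fun [set: T1] (rV_coord i \o f)) ->
  measurable_fun [set: T1] f.
Proof.
move=> mf; suff : g_sigma_preimage (fun i => rV_coord i \o f) `<=` measurable.
  rewrite g_sigma_preimage_comp => + _ A mA; apply.
  by exists A.
apply: smallest_sub; first exact: sigma_algebra_measurable.
rewrite -bigcup_seq; apply: bigcup_sub => i _.
by move=> A [B mB <-]; exact: mf.
Qed.

End measurable_rV.

Section lebesgue_rV.
Context (R : realType).
Local Open Scope ereal_scope.

Definition rV_cons n (p : measurableTypeR R * 'rV[R]_n) : 'rV[R]_n.+1 :=
  row_mx (p.1 : R)%:M p.2 : 'rV[R]_(1 + n).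

Lemma rV_cons0 n p : @rV_cons n p ord0 ord0 = p.1.
Proof.
by rewrite /rV_cons mxE; case: fintype.splitP => // j _;
  rewrite mxE !ord1 eqxx mulr1n.
Qed.

Lemma rV_consS n p i : @rV_cons n p ord0 (lift ord0 i) = p.2 ord0 i.
Proof.
rewrite /rV_cons mxE; case: fintype.splitP => [j|j].
  by rewrite (ord1 j).
by move=> /(congr1 predn) /= /val_inj ->.
Qed.

Lemma measurable_rV_cons n : measurable_fun setT (@rV_cons n).
Proof.
apply: measurable_fun_rVP => i.
rewrite (_ : rV_coord i \o _ = fun p =>
  if fintype.split (i : 'I_(1 + n)) is inr k then rV_coord k p.2 else p.1); last first.
  apply/funext => p /=; rewrite /rV_coord /rV_cons mxE.
  by case: fintype.splitP => j _; rewrite /= ?mxE ?ord1 ?eqxx ?mulr1n.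
case: fintype.split => [_|k]; first exact: measurable_fst.
by apply: measurableT_comp; [exact: measurable_rV_coord|exact: measurable_snd].
Qed.

Section lebesgue_rV_succ.
Context (n : nat) (mu : {sigma_finite_measure set 'rV[R]_n -> \bar R}).

Definition lebesgue_rV_succ : set 'rV[R]_n.+1 -> \bar R :=
  pushforward (@lebesgue_measure R \x mu) (@rV_cons n).

Let succ : {measure set 'rV[R]_n.+1 -> \bar R} :=
  measure_function_pushforward__canonical__measure_function_Measure
    (@lebesgue_measure R \x mu) (@measurable_rV_cons n).

Let succ0 : lebesgue_rV_succ set0 = 0.
Proof. exact: (measure0 succ). Qed.

Let succ_ge0 A : 0 <= lebesgue_rV_succ A.
Proof. exact: (measure_ge0 succ). Qed.

Let succ_sigma_additive : semi_sigma_additive lebesgue_rV_succ.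
Proof. exact: (@measure_semi_sigma_additive _ _ _ succ). Qed.

HB.instance Definition _ := isMeasure.Build _ _ _ lebesgue_rV_succ
  succ0 succ_ge0 succ_sigma_additive.

Let succ_sigma_finite : sigma_finite setT lebesgue_rV_succ.
Proof.
have /sigma_finiteP[F [TF ndF Foo]] := sigma_finiteT (@lebesgue_measure R).
have /sigma_finiteP[G [TG ndG Goo]] := sigma_finiteT mu.
pose tl (x : 'rV[R]_n.+1) : 'rV[R]_n := rsubmx (x : 'rV_(1 + n)).
have mtl : measurable_fun setT tl.
  apply: measurable_fun_rVP => i.
  rewrite (_ : _ \o _ = rV_coord (rshift 1 i)); first exact: measurable_rV_coord.
  by apply/funext => x; rewrite /rV_coord /= mxE.
have mhd := @measurable_rV_coord R n.+1 ord0.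
exists (fun k => rV_coord ord0 @^-1` F k `&` tl @^-1` G k).
  apply/esym; rewrite -subTset => x _.
  have : [set: measurableTypeR R] (rV_coord ord0 x) by [].
  have : [set: 'rV[R]_n] (tl x) by [].
  rewrite TF TG => -[k _ Gk] [l _ Fl]; exists (maxn k l) => //; split.
    by have /subsetPset := ndF _ _ (leq_maxr k l); apply.
  by have /subsetPset := ndG _ _ (leq_maxl k l); apply.
move=> k; have [mF Fk] := Foo k; have [mG Gk] := Goo k; split.
  apply: measurableI.
    by rewrite -[X in measurable X]setTI; exact: mhd.
  by rewrite -[X in measurable X]setTI; exact: mtl.
rewrite /lebesgue_rV_succ /pushforward.
rewrite (_ : _ @^-1` _ = F k `*` G k).
  by rewrite product_measure1E// lte_mul_pinfty// ge0_fin_numE.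
by apply/seteqP; split => -[r v] /=; rewrite /tl /rV_coord row_mxKr rV_cons0.
Qed.

HB.instance Definition _ := Measure_isSigmaFinite.Build _ _ _ lebesgue_rV_succ
  succ_sigma_finite.

End lebesgue_rV_succ.

(* n-dimensional Lebesgue measure, as an iterated product. *)
Fixpoint lebesgue_rV n : {sigma_finite_measure set 'rV[R]_n -> \bar R} :=
  if n is m.+1 then lebesgue_rV_succ (lebesgue_rV m) else dirac (0%R : 'rV[R]_0).

End lebesgue_rV.

Lemma measurable_rV_box (R : realType) n (r : R) :
  measurable [set x : 'rV[R]_n | forall i, - r <= x ord0 i <= r].
Proof.
rewrite (_ : [set _ | _] =
    \big[setI/setT]_(i < n) (rV_coord i @^-1` `[- r, r])); last first.
  rewrite -bigcap_seq; apply/seteqP; split => [x xr i _|x xr i].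
    by rewrite /= in_itv; exact: xr.
  by have := xr i; rewrite /= in_itv /=; apply; exact: mem_index_enum.
apply: big_ind => //; first by move=> *; exact: measurableI.
by move=> i _; rewrite -[X in measurable X]setTI; exact: measurable_rV_coord.
Qed.

Lemma lebesgue_rV_box (R : realType) n (r : R) : 0 <= r ->
  lebesgue_rV R n [set x | forall i, - r <= x ord0 i <= r] =
  ((r *+ 2) ^+ n)%:E.
Proof.
move=> r0; elim: n => [|n IHn].
  by rewrite /= diracE mem_set// => -[].
rewrite /= /lebesgue_rV_succ /pushforward.
rewrite (_ : _ @^-1` _ = (`[- r, r] : set (measurableTypeR R)) `*`
    [set x : 'rV[R]_n | forall i, - r <= x ord0 i <= r]); last first.
  apply/seteqP; split => -[s v] /=; rewrite in_itv /=.
    move=> H; split => [|i]; first by have := H ord0; rewrite rV_cons0.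
    by have := H (lift ord0 i); rewrite rV_consS.
  by move=> [sr vr] i; case: (unliftP ord0 i) => [j|] ->;
    rewrite ?rV_consS ?rV_cons0.
rewrite product_measure1E//; last exact: measurable_rV_box.
rewrite [X in (X * _)%E](_ : _ = (r *+ 2)%:E); last first.
  apply: (etrans (@lebesgue_measure_itv R `[- r, r])); rewrite /= lte_fin.
  case: ltP => [_|r_le]; first by rewrite -EFinD opprK -mulr2n.
  by have -> : r = 0; [lra|rewrite mul0rn].
by rewrite [X in (_ * X)%E]IHn exprS EFinM.
Qed.

Section euclidean.
Context (R : realType) (n : nat).
Implicit Types u v x : 'rV[R]_n.

Definition dotv u v : R := \sum_i u ord0 i * v ord0 i.

(* The norm [`|u|] of the library is the maximum norm. *)
Definition enorm u : R := Num.sqrt (dotv u u).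

Definition unit_ball : set 'rV[R]_n := [set x | enorm x <= 1].

Definition unit_sphere : set 'rV[R]_n := [set x | enorm x = 1].

Definition normalize x := (enorm x)^-1 *: x.

Definition orthogonal_space u : set 'rV[R]_n := [set y | dotv u y = 0].

Lemma measurable_enorm : measurable_fun setT (enorm : _ -> measurableTypeR R).
Proof.
apply: (@measurableT_comp _ _ _ _ _ _ (Num.sqrt : _ -> measurableTypeR R)).
  exact: (continuous_measurable_fun (@sqrt_continuous R)).
apply: measurable_sum => i.
by apply: measurable_funM; exact: measurable_rV_coord.
Qed.

Lemma measurable_unit_ball : measurable unit_ball.
Proof.
rewrite (_ : unit_ball = setT `&` (enorm @^-1` `]-oo, 1%R])); last first.
  by rewrite setTI; apply/seteqP; split => x /=; rewrite in_itv.
by apply: measurable_enorm => //; exact: measurable_itv.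
Qed.

Lemma measurable_normalize : measurable_fun setT normalize.
Proof.
apply: measurable_fun_rVP => i.
rewrite (_ : _ \o _ = fun x => (enorm x)^-1 * x ord0 i); last first.
  by apply/funext => x; rewrite /rV_coord /normalize /= mxE.
apply: measurable_funM; last exact: measurable_rV_coord.
rewrite (_ : (fun x => _) = (@powR R ^~ (-1)) \o enorm).
  by apply: measurableT_comp; [exact: measurable_powR|exact: measurable_enorm].
by apply/funext => x /=; rewrite powR_inv1// sqrtr_ge0.
Qed.

Lemma lebesgue_unit_ball_gt0 : (0 < lebesgue_rV R n unit_ball)%E.
Proof.
have n0 : 0 < n.+1%:R^-1 :> R by rewrite invr_gt0.
apply: (@lt_le_trans _ _ ((n.+1%:R^-1 *+ 2) ^+ n)%:E).
  by rewrite lte_fin exprn_gt0// pmulrn_rgt0.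
rewrite -(lebesgue_rV_box _ (ltW n0)).
apply: le_measure; rewrite ?inE; [exact: measurable_rV_box|
  exact: measurable_unit_ball|move=> x xr].
rewrite /unit_ball /= /enorm -sqrtr1 ler_wsqrtr// /dotv.
apply: (@le_trans _ _ (\sum_(i < n) n.+1%:R^-1)).
  apply: ler_sum => i _; have := xr i.
  have : n.+1%:R^-1 <= 1 :> R by rewrite invf_le1// ler1n.
  move: (n.+1%:R^-1) n0 => s; nra.
rewrite sumr_const card_ord -[leLHS]mulr_natl ler_pdivrMr ?ltr0n// mul1r ler_nat.
exact: leqnSn.
Qed.

Lemma lebesgue_unit_ball_lty : (lebesgue_rV R n unit_ball < +oo)%E.
Proof.
apply: (@le_lt_trans _ _ ((1 *+ 2) ^+ n)%:E); last exact: ltry.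
rewrite -lebesgue_rV_box//.
apply: le_measure; rewrite ?inE; [exact: measurable_unit_ball|
  exact: measurable_rV_box|move=> x xr i].
rewrite -ler_norml -(@ler_pXn2r _ 2)// ?nnegrE// expr1n real_normK ?num_real//.
have : dotv x x <= 1.
  by rewrite -(@ler_sqrt _ _ 1)// sqrtr1.
apply: le_trans; rewrite /dotv (bigD1 i)//= -expr2 lerDl.
by apply: sumr_ge0 => j _; rewrite -expr2 sqr_ge0.
Qed.

End euclidean.
Arguments unit_ball : clear implicits.
Arguments unit_sphere : clear implicits.

Section sphere.
Context (R : realType) (d : nat).
Local Notation vec := 'rV[R]_d.+1.
Local Notation Sd := (unit_sphere R d.+1).
Implicit Types (e x y : vec) (K C : set vec) (r : R).

(* Normalized spherical Lebesgue measure, as the normalized cone measure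
   A |-> lambda {x in B : x / |x| in A} / lambda B, with B the unit ball of
   R^(d+1). It lives on the ambient space and is concentrated on the sphere:
   the origin, where [normalize] is 0, is a null set. *)
Definition sphere_measure (A : set vec) : \bar R :=
  (((fine (lebesgue_rV R d.+1 (unit_ball R d.+1)))^-1)%:E *
   lebesgue_rV R d.+1 (@normalize R d.+1 @^-1` A `&` unit_ball R d.+1))%E.

Let unit_ball_fine_ge0 :
  0 <= (fine (lebesgue_rV R d.+1 (unit_ball R d.+1)))^-1.
Proof. by rewrite invr_ge0 fine_ge0. Qed.

Let cone_measure : {measure set vec -> \bar R} :=
  mscale (NngNum unit_ball_fine_ge0)
    (measure_function_pushforward__canonical__measure_function_Measure
      (mrestr (lebesgue_rV R d.+1) (@measurable_unit_ball R d.+1))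
      (@measurable_normalize R d.+1)).

Let sphere_measure0 : sphere_measure set0 = 0%E.
Proof. exact: (measure0 cone_measure). Qed.

Let sphere_measure_ge0 A : (0 <= sphere_measure A)%E.
Proof. exact: (measure_ge0 cone_measure). Qed.

Let sphere_measure_sigma_additive : semi_sigma_additive sphere_measure.
Proof. exact: (@measure_semi_sigma_additive _ _ _ cone_measure). Qed.

HB.instance Definition _ := isMeasure.Build _ _ _ sphere_measure
  sphere_measure0 sphere_measure_ge0 sphere_measure_sigma_additive.

Let sphere_measure_setT : sphere_measure setT = 1%E.
Proof.
rewrite /sphere_measure preimage_setT setTI.
have b0 := lebesgue_unit_ball_gt0 R d.+1.
have boo := lebesgue_unit_ball_lty R d.+1.
rewrite -[X in (_ * X)%E]fineK ?ge0_fin_numE// -EFinM mulVf//.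
by rewrite gt_eqF// fine_gt0// b0.
Qed.

HB.instance Definition _ := Measure_isProbability.Build _ _ _ sphere_measure
  sphere_measure_setT.

Definition geodesic_ball e r : set vec := [set x | Sd x /\ acos (dotv e x) <= r].

Definition closed_convex_cone C : Prop :=
  [/\ C !=set0, closed C, convex_set (C : set (convex_lmodType vec))
    & forall t x, 0 <= t -> C x -> C (t *: x)].

Definition linear_subspace C : Prop :=
  exists V : {vspace vec}, C = [set x | x \in V].

Definition spherically_convex_body K : Prop :=
  exists C, [/\ closed_convex_cone C, ~ linear_subspace C & K = Sd `&` C].

Definition centered_body e K : Prop :=
  [/\ spherically_convex_body K, K e & K `<=` geodesic_ball e (pi / 2)].

Definition U_functional e K : \bar R :=
  \int[sphere_measure]_(x in Sd)
    (\1_[set z | orthogonal_space (z - e) `&` K !=set0] x)%:E.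

(* For bodies in [centered_body e] the supremum and the infimum are attained,
   since K is compact, and both lie in `[0, pi / 2]. *)
Definition inradius e K : R := sup [set r | 0 <= r /\ geodesic_ball e r `<=` K].

Definition circumradius e K : R :=
  inf [set r | 0 <= r /\ K `<=` geodesic_ball e r].

Definition size_functional e K : R := inradius e K.

Definition deviation e K : R := circumradius e K - inradius e K.

End sphere.

(* Main.v *)
(* A point [x] of the sphere other than [e] lies in the set measured by [U] as
   soon as [<y, x> >= <y, e>] for some [y] in [K]: the hyperplane [(x - e)^perp]
   then separates [e] from [y] weakly, so it meets the arc of [K] between them.
   Hence that set is the union of the balls [B(y, d(y, e))], [y] in [K]. For
   [K = B(e, a)] it is [B(e, 2a)], and in general it contains [B(e, 2a)].

   If [K] has a point [y] at distance [beta >= a + 3 eps / 4] from [e], then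
   [B(y, beta)] leaves [B(e, 2a)] near the direction of [y]. In the cone over
   [B(y, beta) \ B(e, 2a)] there is a box centred at the direction at angle
   [2a + 3 eps / 4] from [e]: its side across that direction is of order
   [eps], the radius of its [(d-1)]-dimensional ball factor is of order
   [sqrt eps]; this yields the exponent [(d + 1) / 2]. The cone over [B(e, 2a)] is
   contained in a slab of width [4a] whose remaining factor is a
   [(d-1)]-dimensional unit ball, so the volume of that ball cancels in the
   comparison. Both volumes are products because Lebesgue measure is invariant
   under reflections. *)

Require Import Defs.
From HB Require Import structures.
From mathcomp Require Import all_boot all_order all_algebra.
From mathcomp Require Import all_classical all_reals all_analysis.
From mathcomp Require Import measurable_realfun ring lra.

Import Order.TTheory GRing.Theory Num.Theory.
Import numFieldNormedType.Exports.

Local Open Scope classical_set_scope.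
Local Open Scope ring_scope.

Lemma muleI_fin {R : realType} (r : R) (x y : \bar R) : r != 0 ->
  (x * r%:E = y * r%:E -> x = y)%E.
Proof.
move=> r0 xy; rewrite -[x]mule1 -[y]mule1 -(divff r0) EFinM.
by rewrite !muleA xy.
Qed.

(** * Translation invariance of Lebesgue measure on the line *)

Section lebesgue_shift.
Context {R : realType}.
Implicit Types h : R.

Lemma measurable_shiftR h :
  measurable_fun setT (fun x : measurableTypeR R => (x + h : measurableTypeR R)).
Proof. by apply: measurable_funD; [exact: measurable_id|exact: measurable_cst]. Qed.

(** The pushforward under a translation agrees with Lebesgue measure on half-open intervals, and
    these determine it. *)
Lemma lebesgue_measure_shift h (A : set (measurableTypeR R)) : measurable A ->
  lebesgue_measure ((fun x : measurableTypeR R => x + h) @^-1` A) =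
  lebesgue_measure A.
Proof.
move=> mA.
pose nu := measure_function_pushforward__canonical__measure_function_Measure
  (@lebesgue_measure R) (measurable_shiftR h).
apply/esym; apply: (@lebesgue_measure_unique R nu) => // _ [[a b]] _ <-.
rewrite /nu/= /pushforward/=.
rewrite (_ : _ @^-1` _ = [set` `]a - h, b - h]%R]); last first.
  by apply/seteqP; split => x /=; rewrite !in_itv/= ltrBlDr lerBrDr.
have -> := @lebesgue_measure_itv R `]a, b]%R.
have -> := @lebesgue_measure_itv R `](a - h), (b - h)]%R.
rewrite /= !lte_fin ltrD2r; case: ifP => // _.
by rewrite -!EFinD; congr EFin; ring.
Qed.

End lebesgue_shift.

(** * Measurability of vector-valued maps *)

Section rV_measurability.
Context {R : realType} {d0 : measure_display} {T : measurableType d0} {n : nat}.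
Implicit Types f g : T -> 'rV[R]_n.

Lemma measurable_rV_coord_comp f i : measurable_fun setT f ->
  measurable_fun setT (fun x => f x ord0 i : measurableTypeR R).
Proof. by move=> mf; exact: (measurableT_comp (@measurable_rV_coord R n i) mf). Qed.

Lemma measurable_rVD f g : measurable_fun setT f -> measurable_fun setT g ->
  measurable_fun setT (fun x => f x + g x).
Proof.
move=> mf mg; apply: measurable_fun_rVP => i.
rewrite (_ : _ \o _ = fun x => f x ord0 i + g x ord0 i).
  by apply: measurable_funD; exact: measurable_rV_coord_comp.
by apply/funext => x; rewrite /rV_coord/= mxE.
Qed.

Lemma measurable_rVZ (k : T -> measurableTypeR R) f :
  measurable_fun setT k -> measurable_fun setT f ->
  measurable_fun setT (fun x => (k x : R) *: f x).
Proof.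
move=> mk mf; apply: measurable_fun_rVP => i.
rewrite (_ : _ \o _ = fun x => (k x : R) * f x ord0 i).
  by apply: measurable_funM => //; exact: measurable_rV_coord_comp.
by apply/funext => x; rewrite /rV_coord/= mxE.
Qed.

Lemma measurable_rVN f : measurable_fun setT f ->
  measurable_fun setT (fun x => - f x).
Proof.
move=> mf; rewrite (_ : (fun x => _) = (fun x => (-1 : R) *: f x)).
  by apply: measurable_rVZ.
by apply/funext => x; rewrite scaleN1r.
Qed.

Lemma measurable_dotv f g : measurable_fun setT f -> measurable_fun setT g ->
  measurable_fun setT (fun x => dotv (f x) (g x) : measurableTypeR R).
Proof.
move=> mf mg; apply: measurable_sum => i.
by apply: measurable_funM; exact: measurable_rV_coord_comp.
Qed.

End rV_measurability.

(** * Lebesgue measure in dimension n under translations and dilations *)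

Section lebesgue_rV_invariance.
Context {R : realType}.
Local Open Scope ereal_scope.

Lemma lebesgue_rV_succE n (A : set 'rV[R]_n.+1) : lebesgue_rV R n.+1 A =
  (@lebesgue_measure R \x lebesgue_rV R n) (@rV_cons R n @^-1` A).
Proof. by []. Qed.

(** Induction on the dimension: a translation acts separately on head and tail, and a product
    measure is determined by its values on rectangles. *)
Lemma lebesgue_rV_shift n (h : 'rV[R]_n) (A : set 'rV[R]_n) : measurable A ->
  lebesgue_rV R n ((fun x => x + h)%R @^-1` A) = lebesgue_rV R n A.
Proof.
elim: n h A => [|n IHn] h A mA.
  congr (lebesgue_rV R 0 _); apply/funext => x /=; congr A.
  by rewrite (thinmx0 h) addr0.
rewrite !lebesgue_rV_succE.
pose h0 : R := h ord0 ord0; pose h' : 'rV[R]_n := rsubmx (h : 'rV_(1 + n)).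
pose s (p : measurableTypeR R * 'rV[R]_n) : measurableTypeR R * 'rV[R]_n :=
  ((p.1 : R) + h0, p.2 + h')%R.
have ms : measurable_fun setT s.
  apply/measurable_fun_pairP; split.
    exact: (measurableT_comp (measurable_shiftR h0) measurable_fst).
  by apply: measurable_rVD; [exact: measurable_snd|exact: measurable_cst].
have sE p : rV_cons (s p) = (rV_cons p + h)%R.
  apply/rowP => i; rewrite [in RHS]mxE.
  case: (unliftP ord0 i) => [j|] ->; last by rewrite !rV_cons0.
  by rewrite !rV_consS /s/= mxE mxE; congr (_ + h _ _)%R; apply: val_inj.
rewrite (_ : _ @^-1` _ = s @^-1` (@rV_cons R n @^-1` A)); last first.
  by apply/funext => p /=; rewrite sE.
pose nu := measure_function_pushforward__canonical__measure_function_Measure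
  (@lebesgue_measure R \x lebesgue_rV R n) ms.
apply/esym; apply: (@product_measure_unique _ _ _ _ _ _ _ nu); last first.
  by rewrite -[X in measurable X]setTI; exact: measurable_rV_cons.
move=> B C mB mC; rewrite /nu/= /pushforward/=.
rewrite (_ : s @^-1` _ =
    ((fun x : measurableTypeR R => x + h0)%R @^-1` B) `*` ((fun x => x + h')%R @^-1` C)) //.
rewrite product_measure1E.
- rewrite IHn//; congr (_ * _); exact: lebesgue_measure_shift.
- by rewrite -[X in measurable X]setTI; exact: measurable_shiftR.
- rewrite -[X in measurable X]setTI; apply: measurable_rVD => //.
Qed.

(* Both sides equal the measure of [{(x, z) | x in B, x + T z in A}], computed
   by slicing along [x] and along [z]. *)
Lemma lebesgue_rV_preimage_proportional n (T T' : 'rV[R]_n -> 'rV[R]_n)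
    (A B : set 'rV[R]_n) :
  {morph T : x y / (x + y)%R} -> cancel T T' -> cancel T' T ->
  measurable_fun setT T -> measurable A -> measurable B ->
  (forall x, B x -> B (- x)%R) ->
  lebesgue_rV R n (T @^-1` A) * lebesgue_rV R n B =
  lebesgue_rV R n A * lebesgue_rV R n (T @^-1` B).
Proof.
move=> TD TK T'K mT mA mB BN.
set mu := lebesgue_rV R n.
have T0 : T 0%R = 0%R.
  by apply: (addrI (T 0%R)); rewrite -TD !addr0.
have TN x : T (- x)%R = (- T x)%R.
  by apply/eqP; rewrite -addr_eq0 -TD addNr T0.
have mpre C : measurable C -> measurable (T @^-1` C).
  by move=> mC; rewrite -[X in measurable X]setTI; exact: mT.
have mTs : measurable_fun setT (fun p : 'rV[R]_n * 'rV[R]_n => T p.2).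
  by apply: (measurableT_comp mT); exact: measurable_snd.
pose D := [set p : 'rV[R]_n * 'rV[R]_n | B p.1 /\ A (p.1 + T p.2)%R].
have mD : measurable D.
  rewrite (_ : D = (fst @^-1` B) `&` ((fun p : 'rV[R]_n * 'rV[R]_n => (p.1 + T p.2)%R) @^-1` A)) //.
  apply: measurableI.
    by rewrite -[X in measurable X]setTI; apply: measurable_fst.
  by rewrite -[X in measurable X]setTI; apply: measurable_rVD.
pose D' := [set p : 'rV[R]_n * 'rV[R]_n | A p.1 /\ B (p.1 - T p.2)%R].
have mD' : measurable D'.
  rewrite (_ : D' = (fst @^-1` A) `&` ((fun p : 'rV[R]_n * 'rV[R]_n => (p.1 - T p.2)%R) @^-1` B)) //.
  apply: measurableI.
    by rewrite -[X in measurable X]setTI; apply: measurable_fst.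
  rewrite -[X in measurable X]setTI; apply: measurable_rVD => //.
  exact: measurable_rVN.
have swap E : measurable E ->
    \int[mu]_x mu (xsection E x) = \int[mu]_y mu (ysection E y).
  move=> mE; have := @indic_fubini_tonelli _ _ _ _ _ mu mu _ mE.
  by rewrite indic_fubini_tonelli_FE// indic_fubini_tonelli_GE.
have cst_on (E : set 'rV[R]_n) (g : 'rV[R]_n -> set 'rV[R]_n) c :
    measurable E -> (forall x, E x -> mu (g x) = c) ->
    (forall x, ~ E x -> g x = set0) -> \int[mu]_x mu (g x) = c * mu E.
  move=> mE gE gN; rewrite -integral_cst// integral_mkcond.
  apply: eq_integral => x _; rewrite patchE; case: ifPn => [/set_mem /gE//|].
  by move=> /negP; rewrite inE => /gN ->; rewrite measure0.
(* For [x] in [B], the slice of [D] is a translate of the preimage of [A] by a multiple of [T' x],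
   so its measure is constant on [B]. *)
transitivity (\int[mu]_x mu (xsection D x)).
  apply/esym/cst_on => // x Bx; last first.
    by apply/seteqP; split => z //; rewrite xsectionE => -[].
  rewrite -(lebesgue_rV_shift _ (T' x) (T @^-1` A)); last exact: mpre.
  congr (mu _); apply/seteqP; split => z; rewrite xsectionE /D/= TD T'K addrC.
    by case.
  by move=> ?; split.
(* Shifting the slice at [z] by [T z] exchanges the roles of [A] and [B] and turns [D] into [D']. *)
rewrite swap//; transitivity (\int[mu]_y mu (ysection D' y)).
  apply: eq_integral => z _.
  rewrite -(lebesgue_rV_shift _ (- T z)%R (ysection D z)); last exact: measurable_ysection.
  congr (mu _); apply/seteqP; split => x; rewrite !ysectionE /D/D'/= => -[].
    by rewrite subrK; split.
  by split => //; rewrite subrK.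
(* Slicing [D'] along [A] gives the sets where [B (x - T z)]; the symmetry of [B] makes them
   translates of the preimage of [B]. *)
rewrite -swap// muleC; apply: cst_on => // x Ax; last first.
  by apply/seteqP; split => z //; rewrite xsectionE => -[].
rewrite -(lebesgue_rV_shift _ (- T' x)%R (T @^-1` B)); last exact: mpre.
congr (mu _); apply/seteqP; split => z; rewrite xsectionE /D'/= TD TN T'K.
  by move=> [_ /BN]; rewrite opprB.
by move=> /BN; rewrite opprB; split.
Qed.

Lemma lebesgue_rV_ball_pos n : exists2 k : R, (0 < k)%R &
  lebesgue_rV R n (unit_ball R n) = k%:E.
Proof.
have b0 := lebesgue_unit_ball_gt0 R n; have boo := lebesgue_unit_ball_lty R n.
exists (fine (lebesgue_rV R n (unit_ball R n))); first by rewrite fine_gt0// b0.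
by rewrite fineK// ge0_fin_numE.
Qed.

(** A dilation changes all volumes by one factor, and the box, whose volume is known at every scale,
    reveals that factor. *)
Lemma lebesgue_rV_ballZ n (r : R) : (0 < r)%R ->
  lebesgue_rV R n [set x | enorm x <= r]%R =
  (r ^+ n)%:E * lebesgue_rV R n (unit_ball R n).
Proof.
move=> r0.
have [k _ kE] := lebesgue_rV_ball_pos n.
have eZ (x : 'rV[R]_n) : enorm (r^-1 *: x) = (r^-1 * enorm x)%R.
  rewrite /enorm (_ : dotv _ _ = (r^-1 ^+ 2 * dotv x x)%R).
    by rewrite sqrtrM ?sqr_ge0// sqrtr_sqr ger0_norm// invr_ge0 ltW.
  by rewrite /dotv mulr_sumr; apply: eq_bigr => i _; rewrite !mxE; ring.
pose box := [set x : 'rV[R]_n | forall i, - 1 <= x ord0 i <= 1]%R.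
have boxE : (fun x => r^-1 *: x)%R @^-1` box =
    [set x | forall i, - r <= x ord0 i <= r]%R.
  apply/seteqP; split => x /= H i; have := H i; rewrite mxE mulrC;
  by rewrite ler_pdivlMr// ler_pdivrMr// mulN1r mul1r.
have ballE : (fun x => r^-1 *: x)%R @^-1` unit_ball R n = [set x | enorm x <= r]%R.
  by apply/seteqP; split => x; rewrite /unit_ball/= eZ mulrC ler_pdivrMr// mul1r.
have : lebesgue_rV R n [set x | enorm x <= r]%R * ((1 *+ 2) ^+ n)%:E =
  lebesgue_rV R n (unit_ball R n) * ((r *+ 2) ^+ n)%:E.
  rewrite -(lebesgue_rV_box _ ler01) -(lebesgue_rV_box _ (ltW r0)) -boxE -ballE.
  apply: (@lebesgue_rV_preimage_proportional n _ (fun x => r *: x)%R).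
  - by move=> x y; rewrite scalerDr.
  - by move=> x; rewrite scalerA divff ?scale1r// gt_eqF.
  - by move=> x; rewrite scalerA mulVf ?scale1r// gt_eqF.
  - by apply: measurable_rVZ.
  - exact: measurable_unit_ball.
  - exact: measurable_rV_box.
  - by move=> x /= H i; rewrite mxE lerNl opprK andbC lerNl; exact: H.
rewrite kE -!EFinM => H.
have {}H : lebesgue_rV R n [set x | enorm x <= r]%R * (2 ^+ n)%:E =
    (r ^+ n * k * 2 ^+ n)%:E.
  by rewrite H; congr EFin; rewrite -(mulr_natr r) exprMn; ring.
by apply: (@muleI_fin _ (2 ^+ n)%R); rewrite ?H// expf_neq0// pnatr_eq0.
Qed.

End lebesgue_rV_invariance.

(** * Algebra of the Euclidean inner product *)

Section dotv_theory.
Context {R : realType} {n : nat}.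
Implicit Types u v w x y : 'rV[R]_n.

Lemma dotvC u v : dotv u v = dotv v u.
Proof. by apply: eq_bigr => i _; rewrite mulrC. Qed.

Lemma dotvDl u v w : dotv (u + v) w = dotv u w + dotv v w.
Proof. by rewrite -big_split; apply: eq_bigr => i _; rewrite mxE mulrDl. Qed.

Lemma dotvZl a u w : dotv (a *: u) w = a * dotv u w.
Proof. by rewrite mulr_sumr; apply: eq_bigr => i _; rewrite mxE mulrA. Qed.

Lemma dotvNl u w : dotv (- u) w = - dotv u w.
Proof. by rewrite -scaleN1r dotvZl mulN1r. Qed.

Lemma dotvBl u v w : dotv (u - v) w = dotv u w - dotv v w.
Proof. by rewrite dotvDl dotvNl. Qed.

Lemma dotvDr u v w : dotv w (u + v) = dotv w u + dotv w v.
Proof. by rewrite !(dotvC w) dotvDl. Qed.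

Lemma dotvZr a u w : dotv w (a *: u) = a * dotv w u.
Proof. by rewrite !(dotvC w) dotvZl. Qed.

Lemma dotvNr u w : dotv w (- u) = - dotv w u.
Proof. by rewrite !(dotvC w) dotvNl. Qed.

Lemma dotvBr u v w : dotv w (u - v) = dotv w u - dotv w v.
Proof. by rewrite dotvDr dotvNr. Qed.

Lemma dotv_ge0 u : 0 <= dotv u u.
Proof. by apply: sumr_ge0 => i _; rewrite -expr2 sqr_ge0. Qed.

Lemma dotv_eq0 u : (dotv u u == 0) = (u == 0).
Proof.
apply/idP/eqP => [|->]; last by rewrite /dotv big1// => i _; rewrite mxE mul0r.
rewrite psumr_eq0 => [/allP H|i _]; last by rewrite -expr2 sqr_ge0.
apply/rowP => i; rewrite mxE; have := H i (mem_index_enum _).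
by rewrite -expr2 expf_eq0/= => /eqP.
Qed.

Lemma dotv0l u : dotv 0 u = 0.
Proof. by rewrite -(scale0r 0) dotvZl mul0r. Qed.

Lemma enorm_sqr u : enorm u ^+ 2 = dotv u u.
Proof. by rewrite sqr_sqrtr// dotv_ge0. Qed.

Lemma enorm_ge0 u : 0 <= enorm u.
Proof. exact: sqrtr_ge0. Qed.

Lemma enorm_le u (r : R) : 0 <= r -> (enorm u <= r) = (dotv u u <= r ^+ 2).
Proof.
by move=> r0; rewrite -enorm_sqr ler_pXn2r// nnegrE// enorm_ge0.
Qed.

Lemma unit_sphereP u : unit_sphere R n u <-> dotv u u = 1.
Proof.
rewrite /unit_sphere/=; split => [u1|u1]; first by rewrite -enorm_sqr u1 expr1n.
by rewrite /enorm u1 sqrtr1.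
Qed.

Lemma dotv_delta i x : dotv x (delta_mx ord0 i) = x ord0 i.
Proof.
rewrite /dotv (bigD1 i)//= mxE !eqxx mulr1 big1 ?addr0// => j /negPf ji.
by rewrite mxE ji andbF mulr0.
Qed.

End dotv_theory.

(** * Reflections and their invariance of volume *)

Section reflection.
Context {R : realType} {n : nat}.
Implicit Types u v w x y : 'rV[R]_n.

(* For [u = 0] this is the identity, since [0^-1 = 0]. *)
Definition reflection u x := x - (2 * dotv x u / dotv u u) *: u.

Lemma reflectionD u : {morph reflection u : x y / x + y}.
Proof.
by move=> x y; rewrite /reflection dotvDl mulrDr mulrDl scalerDl; 
  rewrite opprD addrACA.
Qed.

Lemma reflectionK u : involutive (reflection u).
Proof.
move=> x; rewrite /reflection.
have [->|u0] := eqVneq u 0; first by rewrite !scaler0 !subr0.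
have uu0 : dotv u u != 0 by rewrite dotv_eq0.
rewrite dotvBl dotvZl -addrA -opprD -scalerDl.
set c := (X in X *: u); have -> : c = 0 by rewrite /c; field.
by rewrite scale0r subr0.
Qed.

Lemma dotv_reflection u x y : dotv (reflection u x) (reflection u y) = dotv x y.
Proof.
rewrite /reflection !(dotvBl, dotvBr, dotvZl, dotvZr) (dotvC u y).
have [u0|u0] := eqVneq (dotv u u) 0; first by rewrite u0 invr0; ring.
by field.
Qed.

Lemma reflection_swap x y : dotv x x = dotv y y -> reflection (x - y) x = y.
Proof.
move=> xy; rewrite /reflection.
have [/eqP|u0] := eqVneq (x - y) 0.
  by rewrite subr_eq0 => /eqP ->; rewrite subrr scaler0 subr0.
have uu0 : dotv (x - y) (x - y) != 0 by rewrite dotv_eq0.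
rewrite (_ : _ / _ = 1) ?scale1r ?subKr//.
have -> : 2 * dotv x (x - y) = dotv (x - y) (x - y); last by rewrite divff.
by rewrite !(dotvBl, dotvBr) (dotvC y x) -xy; ring.
Qed.

Lemma reflection_fix u x : dotv x u = 0 -> reflection u x = x.
Proof. by move=> xu; rewrite /reflection xu mulr0 mul0r scale0r subr0. Qed.

Lemma measurable_reflection u : measurable_fun setT (reflection u).
Proof.
apply: measurable_rVD; first exact: measurable_id.
apply: measurable_rVN; apply: measurable_rVZ => //.
apply: measurable_funM => //; apply: measurable_funM => //.
exact: measurable_dotv.
Qed.

(** The proportionality factor is 1, because a reflection maps the unit ball, of finite positive
    volume, onto itself. *)
Lemma lebesgue_rV_reflection u (A : set 'rV[R]_n) : measurable A ->
  lebesgue_rV R n (reflection u @^-1` A) = lebesgue_rV R n A.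
Proof.
move=> mA; have [k k0 kE] := @lebesgue_rV_ball_pos R n.
have := @lebesgue_rV_preimage_proportional R n (reflection u) (reflection u) A
  (unit_ball R n) (reflectionD u) (reflectionK u) (reflectionK u)
  (measurable_reflection u) mA (@measurable_unit_ball R n).
rewrite (_ : _ @^-1` unit_ball R n = unit_ball R n); last first.
  by apply/seteqP; split => x; rewrite /unit_ball/= /enorm dotv_reflection.
rewrite kE => H; apply: (@muleI_fin R k); first by rewrite gt_eqF.
by apply: H => x; rewrite /unit_ball/= /enorm dotvNl dotvNr opprK.
Qed.

End reflection.

(** * Boxes in an orthonormal frame and their volume *)

Section frame.
Context {R : realType} {n : nat}.
Implicit Types (p q x : 'rV[R]_n.+2) (I J : set (measurableTypeR R)) (r : R).

(** For orthonormal [p], [q] the last condition bounds the squared distance from [x] to their span,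
    so this is a product of [I], [J] and an n-dimensional ball. *)
Definition frame_box p q I J r : set 'rV[R]_n.+2 :=
  [set x | [/\ I (dotv x p), J (dotv x q) &
              dotv x x - dotv x p ^+ 2 - dotv x q ^+ 2 <= r ^+ 2]].

Lemma measurable_frame_box p q I J r : measurable I -> measurable J ->
  measurable (frame_box p q I J r).
Proof.
move=> mI mJ.
have mp : measurable_fun setT (fun x => dotv x p : measurableTypeR R).
  by apply: measurable_dotv.
have mq : measurable_fun setT (fun x => dotv x q : measurableTypeR R).
  by apply: measurable_dotv.
have mx : measurable_fun setT (fun x : 'rV[R]_n.+2 => dotv x x : measurableTypeR R).
  by apply: measurable_dotv.
rewrite (_ : frame_box _ _ _ _ _ = ((fun x => dotv x p) @^-1` I) `&`
   (((fun x => dotv x q) @^-1` J) `&`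
   ((fun x => dotv x x - dotv x p ^+ 2 - dotv x q ^+ 2) @^-1` `]-oo, r ^+ 2]))).
  apply: measurableI; first by rewrite -[X in measurable X]setTI; exact: mp.
  apply: measurableI; first by rewrite -[X in measurable X]setTI; exact: mq.
  rewrite -[X in measurable X]setTI.
  suff : measurable_fun setT
    (fun x => dotv x x - dotv x p ^+ 2 - dotv x q ^+ 2 : measurableTypeR R).
    by apply => //; exact: measurable_itv.
  apply: measurable_funB; last exact: measurable_funX.
  by apply: measurable_funB => //; exact: measurable_funX.
apply/seteqP; split => x; rewrite /frame_box/= in_itv/=; first by case.
by move=> [? []].
Qed.

Let e0 : 'rV[R]_n.+2 := delta_mx ord0 ord0.
Let e1 : 'rV[R]_n.+2 := delta_mx ord0 (lift ord0 ord0).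

(** Two reflections carry [p], [q] to the first two coordinate vectors, where the box is a genuine
    product. The second one leaves [e0] in place, since both [q1] and [e1] are orthogonal to it. *)
Lemma lebesgue_frame_box p q I J r : dotv p p = 1 -> dotv q q = 1 ->
  dotv p q = 0 -> measurable I -> measurable J -> 0 <= r ->
  lebesgue_rV R n.+2 (frame_box p q I J r) = (lebesgue_measure I *
    (lebesgue_measure J * lebesgue_rV R n [set w | (enorm w <= r)%R]))%E.
Proof.
move=> pp qq pq mI mJ r0.
have e00 : dotv e0 e0 = 1 by rewrite dotv_delta mxE !eqxx.
have e11 : dotv e1 e1 = 1 by rewrite dotv_delta mxE !eqxx.
have e01 : dotv e0 e1 = 0 by rewrite dotv_delta mxE.
pose h1 := reflection (p - e0); pose q1 := h1 q; pose h2 := reflection (q1 - e1).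
have h1p : h1 p = e0 by apply: reflection_swap; rewrite pp e00.
have h2q : h2 q1 = e1.
  by apply: reflection_swap; rewrite /q1 dotv_reflection qq e11.
have h2e : h2 e0 = e0.
  apply: reflection_fix; rewrite dotvBr e01 subr0 /q1 -h1p dotv_reflection//.
have -> : frame_box p q I J r = h1 @^-1` (h2 @^-1` frame_box e0 e1 I J r).
  apply/funext => x; rewrite /frame_box/= -[in RHS]h2e -[in RHS]h2q !dotv_reflection.
  by rewrite -h1p /q1 !dotv_reflection.
have mB := measurable_frame_box e0 e1 I J r mI mJ.
rewrite !lebesgue_rV_reflection//; last first.
  by rewrite -[X in measurable X]setTI; exact: measurable_reflection.
have mB' : measurable [set w : 'rV[R]_n | enorm w <= r].
  rewrite (_ : [set _ | _] = (@enorm R n : _ -> measurableTypeR R) @^-1` `]-oo, r]).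
    rewrite -[X in measurable X]setTI.
    by apply: (@measurable_enorm R n) => //; exact: measurable_itv.
  by apply/seteqP; split => x /=; rewrite in_itv.
have dE m (z : measurableTypeR R * 'rV[R]_m) :
    dotv (rV_cons z) (rV_cons z) = (z.1 : R) ^+ 2 + dotv z.2 z.2.
  rewrite {1}/dotv big_ord_recl !rV_cons0 -expr2; congr (_ + _).
  by apply: eq_bigr => i _; rewrite !rV_consS.
pose F : set 'rV[R]_n.+1 :=
  [set v : 'rV[R]_n.+1 | J (v ord0 ord0) /\ dotv v v - v ord0 ord0 ^+ 2 <= r ^+ 2].
have E0 : @rV_cons R n.+1 @^-1` frame_box e0 e1 I J r = I `*` F.
  apply/seteqP; split => -[s v];
    rewrite /frame_box /F/= !dotv_delta rV_cons0 rV_consS dE/= [_ + dotv _ _]addrC addrK.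
    by case.
  by move=> [? []].
have E1 : @rV_cons R n @^-1` F = J `*` [set w | enorm w <= r].
  apply/seteqP; split => -[s v];
    by rewrite /F/= rV_cons0 dE/= [_ + dotv _ _]addrC addrK enorm_le.
have mF : measurable F.
  rewrite (_ : F = ((fun v : 'rV[R]_n.+1 => v ord0 ord0) @^-1` J) `&`
   ((fun v : 'rV[R]_n.+1 => dotv v v - v ord0 ord0 ^+ 2) @^-1` `]-oo, r ^+ 2])).
    have mc := @measurable_rV_coord R n.+1 ord0.
    apply: measurableI; first by rewrite -[X in measurable X]setTI; exact: mc.
    rewrite -[X in measurable X]setTI.
    suff : measurable_fun setT
      (fun v : 'rV[R]_n.+1 => dotv v v - v ord0 ord0 ^+ 2 : measurableTypeR R).
      by apply => //; exact: measurable_itv.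
    apply: measurable_funB; last exact: measurable_funX.
    by apply: measurable_dotv.
  by apply/seteqP; split => x; rewrite /F/= in_itv.
rewrite lebesgue_rV_succE E0 product_measure1E//; congr (_ * _)%E.
by rewrite lebesgue_rV_succE E1 product_measure1E.
Qed.

End frame.

(** * Trigonometric inequalities *)

Section trigonometry.
Context {R : realType}.
Implicit Types x y u z a b h : R.

Lemma sin_mean_value x : 0 < x -> exists2 c, 0 < c < x & sin x = cos c * x.
Proof.
move=> x0; have [|c] := @MVT R sin cos 0 x x0 (fun y _ => is_derive_sin y).
  by apply: continuous_subspaceT => y; exact: continuous_sin.
by rewrite in_itv/= sin0 !subr0; exists c.
Qed.

Lemma sin_le_id x : 0 <= x -> sin x <= x.
Proof.
rewrite le_eqVlt => /predU1P[<-|x0]; first by rewrite sin0.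
have [c _ ->] := sin_mean_value _ x0.
by rewrite ler_piMl ?cos_le1// ltW.
Qed.

Lemma cos_half x : cos x = 1 - 2 * sin (x / 2) ^+ 2.
Proof. by rewrite [in LHS](splitr x) cosD -!expr2 cos2sin2; ring. Qed.

(** By the mean value theorem [sin x = cos c * x] with [c < 1], and
    [cos c = 1 - 2 * sin (c / 2) ^+ 2] is at least 1/2. *)
Lemma half_le_sin x : 0 <= x <= 1 -> x / 2 <= sin x.
Proof.
have pi2 := @pi_ge2 R.
move=> /andP[]; rewrite le_eqVlt => /predU1P[<- _|x0 x1]; first by rewrite sin0 mul0r.
have [c /andP[c0 cx] ->] := sin_mean_value _ x0.
rewrite mulrC ler_pM2r// cos_half.
have s1 : sin (c / 2) <= c / 2 by apply: sin_le_id; lra.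
have s0 : 0 <= sin (c / 2) by apply: sin_ge0_pi; lra.
nra.
Qed.

(** The triple angle formula at [pi / 6] forces [sin (pi / 6) = 1 / 2], and [sin x <= x]
    concludes. *)
Lemma pi_ge3 : 3 <= pi :> R.
Proof.
have p2 := @pi_ge2 R.
have : sin (pi / 2 : R) = 1 by rewrite sin_pihalf.
have -> : pi / 2 = pi / 6 + (pi / 6 + pi / 6) :> R by lra.
have sp : 0 < sin (pi / 6 : R) by apply: sin_gt0_pi; lra.
have sl : sin (pi / 6 : R) <= pi / 6 by apply: sin_le_id; lra.
have c2 := cos2Dsin2 (pi / 6 : R).
rewrite !(sinD, cosD); move: (cos _) c2 sp sl => c; move: (sin _) => s c2 sp sl E.
have {}c2 : c ^+ 2 = 1 - s ^+ 2 by lra.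
have {E} : 3 * s * c ^+ 2 - s ^+ 3 = 1 by apply: etrans E; ring.
rewrite c2 => E.
(* This factors [4 * s ^+ 3 - 3 * s + 1]; the root -1 is excluded by [0 < s]. *)
have : (s + 1) * (2 * s - 1) ^+ 2 = 0.
  transitivity (1 - (3 * s * (1 - s ^+ 2) - s ^+ 3)); first by ring.
  by rewrite E subrr.
move=> /eqP; rewrite mulf_eq0 sqrf_eq0 => /orP[/eqP|/eqP]; lra.
Qed.

Lemma cosB_sin x y : cos x - cos y = 2 * sin ((x + y) / 2) * sin ((y - x) / 2).
Proof.
have -> : cos x = cos ((x + y) / 2 - (y - x) / 2) by congr cos; lra.
have -> : cos y = cos ((x + y) / 2 + (y - x) / 2) by congr cos; lra.
rewrite cosB cosD; ring.
Qed.

Lemma sinB_sin x y : sin x - sin y = 2 * cos ((x + y) / 2) * sin ((x - y) / 2).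
Proof.
have -> : sin x = sin ((x + y) / 2 + (x - y) / 2) by congr sin; lra.
have -> : sin y = sin ((x + y) / 2 - (x - y) / 2) by congr sin; lra.
rewrite sinB sinD; ring.
Qed.

Lemma sin_ge_between u z : 0 <= u -> u <= z <= pi - u -> sin u <= sin z.
Proof.
move=> u0 uz; rewrite -subr_ge0 sinB_sin !mulr_ge0//.
  by apply: cos_ge0_pihalf; lra.
by apply: sin_ge0_pi; lra.
Qed.

Lemma le_cos_pi x y : 0 <= x -> x <= y -> y <= pi -> cos y <= cos x.
Proof.
move=> x0 xy yp; rewrite -subr_ge0 cosB_sin !mulr_ge0//; apply: sin_ge0_pi; lra.
Qed.

(* [tau] and [sigma] are the coordinates of a point of norm [N] along the
   direction at angle [2 * a + h] from [e] in the plane of [e] and [y], and along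
   its normal in that plane. The last two inequalities say that the point makes
   an angle more than [2 * a] with [e], and is no farther from the point of that
   plane at angle [a + h] than [e] is. *)
Lemma box_angle_bounds (a eps h m tau sigma N : R) :
  0 < a -> 0 < eps <= 1 -> a + eps <= pi / 2 -> h = 3 / 4 * eps ->
  m = Num.min a (pi / 2 - a) ->
  1 / 2 <= tau <= 9 / 10 -> `|sigma| <= h / 16 -> 0 <= N ->
  tau ^+ 2 + sigma ^+ 2 <= N ^+ 2 ->
  N ^+ 2 - tau ^+ 2 - sigma ^+ 2 <= eps * m ^+ 2 / 25 ->
  [/\ N <= 1,
      tau * cos (2 * a + h) - sigma * sin (2 * a + h) < N * cos (2 * a) &
      N * cos (a + h) <= tau * cos a - sigma * sin a].
Proof.
move=> a0 /andP[e0 e1] aep hE mE /andP[t1 t2] sh N0 Nlb Nub.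
have pi3 := pi_ge3; have pi4 := @pihalf_lt2 R.
have m0 : 0 < m by rewrite mE lt_min a0/=; lra.
have ma : m <= a by rewrite mE ge_min lexx.
have mp : m <= pi / 2 - a by rewrite mE ge_min lexx orbT.
have m1 : m <= 1 by lra.
have h0 : 0 < h by lra.
have h1 : h <= 3 / 4 by lra.
set S1 := sin (a + h / 2); set S2 := sin (2 * a + h / 2); set sh2 := sin (h / 2).
(* The angles [a + h / 2] and [2 * a + h / 2] lie in [[h / 2, pi - h / 2]] and in [[m, pi - m]], so
   [S1] and [S2] are at least [h / 4] and [m / 2]. *)
have shl : h / 4 <= sh2 by have := @half_le_sin (h / 2); rewrite -/sh2; lra.
have sm : m / 2 <= sin m by apply: half_le_sin; lra.
have S1h : sh2 <= S1 by apply: sin_ge_between; lra.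
have S2h : sh2 <= S2 by apply: sin_ge_between; lra.
have S1m : m / 2 <= S1 by apply: le_trans sm _; apply: sin_ge_between; lra.
have S2m : m / 2 <= S2 by apply: le_trans sm _; apply: sin_ge_between; lra.
have S1a : sin a <= S1 by apply: sin_ge_between; lra.
have sa0 : 0 <= sin a by apply: sin_ge0_pi; lra.
have st0 : 0 <= sin (2 * a + h) by apply: sin_ge0_pi; lra.
have S2t : sin (2 * a + h) <= 2 * S2.
  have -> : 2 * a + h = (2 * a + h / 2) + h / 2 by lra.
  rewrite sinD -/S2 -/sh2.
  have := cos_le1 (h / 2); have := cos_le1 (2 * a + h / 2).
  move: (cos _) (cos _) => c1 c2 c1l c2l; nra.
have /andP[sl su] : - (h / 16) <= sigma <= h / 16 by rewrite -ler_norml.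
pose nu := N - tau.
have Nt : tau <= N.
  rewrite -(@ler_pXn2r _ 2)// ?nnegrE; [|lra].
  by have := sqr_ge0 sigma; lra.
have nu0 : 0 <= nu by rewrite subr_ge0.
(* Since [N + tau >= 1], [nu] is at most [N ^+ 2 - tau ^+ 2], which the hypotheses bound; 4/75 comes
   from [eps = 4 / 3 * h]. *)
have nuB : nu <= h ^+ 2 / 256 + 4 / 75 * h * m ^+ 2.
  have s2 : sigma ^+ 2 <= h ^+ 2 / 256 by nra.
  have epsE : eps = 4 / 3 * h by lra.
  rewrite epsE in Nub.
  have : nu * (N + tau) <= sigma ^+ 2 + 4 / 3 * h * m ^+ 2 / 25.
    rewrite (_ : nu * _ = N ^+ 2 - tau ^+ 2); [lra|rewrite /nu; ring].
  have : nu <= nu * (N + tau) by rewrite ler_peMr//; lra.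
  lra.
(* The factor is 4/256 + 8/75, rounded up. *)
have nuS S : h / 4 <= S -> m / 2 <= S -> nu <= 123 / 1000 * (h * S).
  move=> hS mS; apply: le_trans nuB _.
  have : h ^+ 2 <= 4 * (h * S) by nra.
  have : m ^+ 2 <= 2 * S by nra.
  nra.
have NE : N = tau + nu by rewrite /nu; ring.
split.
- have : nu <= 1 / 10 by nra.
  lra.
- have := cosB_sin (2 * a) (2 * a + h).
  have -> : (2 * a + (2 * a + h)) / 2 = 2 * a + h / 2 by lra.
  have -> : (2 * a + h - 2 * a) / 2 = h / 2 by lra.
  rewrite -/S2 -/sh2 => D.
  have n2 : nu <= 123 / 1000 * (h * S2) by apply: nuS; lra.
  have c1 := cos_geN1 (2 * a).
  have sB : - sigma * sin (2 * a + h) <= h / 8 * S2.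
    by apply: (@le_trans _ _ (h / 16 * sin (2 * a + h))); nra.
  have tB : h * S2 / 4 <= tau * (2 * S2 * sh2).
    have : h * S2 / 4 <= S2 * sh2 by nra.
    nra.
  have hS : 0 < h * S2 by nra.
  have nc : - nu <= nu * cos (2 * a) by nra.
  move: tB; rewrite -D mulrBr NE (mulrDl tau nu); lra.
- have := cosB_sin a (a + h).
  have -> : (a + (a + h)) / 2 = a + h / 2 by lra.
  have -> : (a + h - a) / 2 = h / 2 by lra.
  rewrite -/S1 -/sh2 => D.
  have n1 : nu <= 123 / 1000 * (h * S1) by apply: nuS; lra.
  have c1 := cos_le1 (a + h).
  have c0 : 0 <= cos (a + h) by apply: cos_ge0_pihalf; lra.
  have sB : sigma * sin a <= h / 16 * S1 by nra.
  have tB : h * S1 / 4 <= tau * (2 * S1 * sh2).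
    have : h * S1 / 4 <= S1 * sh2 by nra.
    nra.
  have hS : 0 < h * S1 by nra.
  have nc : nu * cos (a + h) <= nu by rewrite ler_piMr.
  move: tB; rewrite -D mulrBr NE (mulrDl tau nu); lra.
Qed.

End trigonometry.

(** * Geodesic balls, bisectors and convex bodies on the sphere *)

Section sphere_geometry.
Context {R : realType} {d : nat}.
Local Notation vec := 'rV[R]_d.+1.
Local Notation Sd := (unit_sphere R d.+1).
Implicit Types (e x y v : vec) (K C : set vec) (r a : R).

Lemma dotv_unit_itv {x y} : Sd x -> Sd y -> -1 <= dotv x y <= 1.
Proof.
move=> /unit_sphereP x1 /unit_sphereP y1.
have := dotv_ge0 (x - y); have := dotv_ge0 (x + y).
rewrite !(dotvDl, dotvDr, dotvNl, dotvNr) x1 y1 (dotvC y x).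
by move=> ? ?; apply/andP; split; lra.
Qed.

Lemma geodesic_ballP {e x r} : Sd e -> 0 <= r <= pi ->
  geodesic_ball e r x <-> Sd x /\ cos r <= dotv e x.
Proof.
move=> e1 /andP[r0 rpi]; rewrite /geodesic_ball/=; split => -[x1 H]; split => //;
  have ex := dotv_unit_itv e1 x1; have exI : dotv e x \in `[-1, 1] by rewrite in_itv.
- by rewrite -(acosK exI); apply: le_cos_pi => //; exact: acos_ge0.
- rewrite leNgt; apply/negP => rlt; move: H; apply/negP; rewrite -ltNge.
  rewrite -[ltLHS](acosK exI) ltr_cos// ?in_itv/=; first by rewrite r0.
  by rewrite acos_ge0// acos_lepi.
Qed.

(** [v] is the normalized component of [y] orthogonal to [e]; the strict bound keeps the sine
    positive. *)
Lemma tangent_decomposition {e y} : Sd e -> Sd y -> `|dotv e y| < 1 ->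
  exists v, [/\ dotv v v = 1, dotv e v = 0 &
    y = cos (acos (dotv e y)) *: e + sin (acos (dotv e y)) *: v].
Proof.
move=> Se Sy; rewrite ltr_norml => /andP[lb ub].
have eyI : dotv e y \in `[-1, 1] by rewrite in_itv/= !ltW.
have /unit_sphereP e1 := Se; have /unit_sphereP y1 := Sy.
have := cos2Dsin2 (acos (dotv e y)).
have : 0 < sin (acos (dotv e y)).
  by apply: sin_gt0_pi; rewrite acos_gt0 ?acos_ltpi ?lb ?ub ?ltW.
rewrite acosK//; set s := sin _; set c := dotv e y => s0 cs.
have s0' : s != 0 by rewrite gt_eqF.
exists (s^-1 *: (y - c *: e)); split; last by rewrite scalerA divff// scale1r subrKC.
  rewrite !(dotvZl, dotvZr, dotvBl, dotvBr) y1 e1 (dotvC y e) -/c.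
  transitivity (s^-1 * (s^-1 * s ^+ 2)); last by field.
  by congr (_ * (_ * _)); lra.
by rewrite !(dotvZl, dotvZr, dotvBl, dotvBr) e1 -/c; ring.
Qed.

(** The sum is twice the midpoint. *)
Lemma cone_add C u v : closed_convex_cone C -> C u -> C v -> C (u + v).
Proof.
move=> [_ _ cC sC] Cu Cv.
have half01 : (0 <= (2^-1 : R)) && ((2^-1 : R) <= 1) by apply/andP; split; lra.
pose t : {i01 R} := Itv01 (elimTF andP half01).1 (elimTF andP half01).2.
have := cC u v t (mem_set Cu) (mem_set Cv); rewrite inE => /(sC 2 _ (ler0n _ _)).
rewrite /conv/= scalerDr !scalerA.
have -> : 2 * 2^-1 = 1 :> R by lra.
have -> : 2 * unstable.onem (2^-1) = 1 :> R by rewrite /unstable.onem; lra.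
by rewrite !scale1r.
Qed.

(** On the sphere, [orthogonal_space (z - e)] is the bisector of [z] and [e] when [z] differs from
    [e]; for [z = e] it is the whole space. *)
Definition bisector_hits e K : set vec :=
  [set z | orthogonal_space (z - e) `&` K !=set0].

Lemma bisector_hits_ball e a : Sd e -> 0 < a < pi / 2 ->
  Sd `&` bisector_hits e (geodesic_ball e a) = geodesic_ball e (2 * a).
Proof.
move=> Se /andP[a0 a1]; have /unit_sphereP e1 := Se.
have ca0 : 0 < cos a by apply: cos_gt0_pihalf; lra.
have c2a : cos (2 * a) = 2 * cos a ^+ 2 - 1.
  by rewrite mulr_natl cos_mulr2n; ring.
apply/seteqP; split => x.
  move=> [Sx [y [/= xy]]]; have /unit_sphereP x1 := Sx.
  move=> /(geodesic_ballP Se) [|Sy ya]; first lra.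
  have /unit_sphereP y1 := Sy.
  apply/(geodesic_ballP Se); first lra; split => //.
  move: xy; rewrite /orthogonal_space/= dotvBl => /eqP; rewrite subr_eq0 => /eqP xy.
  (* Subtracting from [x + e] its projection onto [y] leaves a nonnegative square, which gives
     [dotv e x >= 2 * dotv e y ^+ 2 - 1]. *)
  have := dotv_ge0 (x + e - (2 * dotv e y) *: y).
  rewrite !(dotvDl, dotvDr, dotvNl, dotvNr, dotvZl, dotvZr) x1 e1 y1.
  rewrite (dotvC y x) (dotvC y e) xy (dotvC x e) c2a.
  have : cos a ^+ 2 <= dotv e y ^+ 2 by rewrite ler_pXn2r// nnegrE; lra.
  lra.
move=> /(geodesic_ballP Se) [|Sx xa]; first lra.
have /unit_sphereP x1 := Sx.
split => //; set s := dotv e x in xa.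
have s1 : 0 < 1 + s.
  have : 0 < cos a ^+ 2 by rewrite exprn_gt0.
  by move: xa; rewrite c2a; lra.
have Nx : dotv (x + e) (x + e) = 2 * (1 + s).
  by rewrite !(dotvDl, dotvDr) x1 e1 (dotvC x e) -/s; ring.
have N0 : 0 < enorm (x + e).
  by rewrite sqrtr_gt0 Nx mulr_gt0.
have N2 := enorm_sqr (x + e); rewrite Nx in N2.
(* The witness is the midpoint of the arc from [e] to [x]; [s1] rules out antipodal points. *)
exists (normalize (x + e)); split.
  rewrite /orthogonal_space/normalize/= dotvZr !(dotvBl, dotvDr) x1 e1 (dotvC e x).
  rewrite -[RHS](mulr0 (enorm (x + e))^-1); congr (_ * _); ring.
have Sn : Sd (normalize (x + e)).
  apply/unit_sphereP; rewrite /normalize dotvZl dotvZr Nx -N2.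
  by field; rewrite gt_eqF.
apply/(geodesic_ballP Se); first lra; split => //.
rewrite /normalize dotvZr dotvDr e1 -/s [s + 1]addrC.
rewrite [leRHS]mulrC ler_pdivlMr//.
(* The left side is [(1 + cos (2 * a)) * (1 + s)]. *)
have H : (cos a * enorm (x + e)) ^+ 2 <= (1 + s) ^+ 2.
  by rewrite exprMn N2; move: xa; rewrite c2a; nra.
have p0 : 0 <= cos a * enorm (x + e) by rewrite mulr_ge0 ?enorm_ge0// ltW.
by move: H; rewrite ler_pXn2r ?nnegrE// ?(ltW s1).
Qed.

(** Angles below [a] are covered by some ball entering the supremum; a point at angle exactly [a] is
    a limit of such points along its geodesic from [e], and the cone is closed. *)
Lemma sub_inradius_ball e K a : Sd e -> spherically_convex_body K ->
  0 < a < pi / 2 -> a <= inradius e K -> geodesic_ball e a `<=` K.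
Proof.
move=> Se [C [[_ cC _ _] _ KE]] /andP[a0 api]; rewrite /inradius.
set S := [set r | _] => aS x xa; have [Sx xle] := xa.
have inK y : Sd y -> acos (dotv e y) < a -> K y.
  (* Without a supremum [sup] takes the default value 0, which contradicts [0 < a]. *)
  move=> Sy ya; have [SS|/sup_out S0] := pselect (has_sup S); last first.
    by move: aS; rewrite S0 leNgt a0.
  have ya' : acos (dotv e y) < sup S by exact: lt_le_trans ya aS.
  have [r [r0 rK] yr] := sup_gt SS.1 ya'.
  by apply: rK; split => //; exact: ltW.
move: xle; rewrite le_eqVlt => /predU1P[xE|]; last exact: inK.
have pi0 := @pi_gt0 R.
have exI := dotv_unit_itv Se Sx.
have exE : dotv e x = cos a by rewrite -xE acosK// in_itv.
have ca0 : 0 < cos a by apply: cos_gt0_pihalf; lra.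
have ca1 : cos a < 1 by rewrite -[ltRHS]cos0 ltr_cos// ?in_itv/=; lra.
have [|v [v1 ev xv]] := tangent_decomposition Se Sx.
  by rewrite exE gtr0_norm.
have /unit_sphereP e1 := Se.
pose z (t : R) : vec := cos t *: e + sin t *: v.
rewrite KE; split => //; rewrite xv xE -/(z a).
apply: (@closed_cvg _ _ (a^'-) _ z C) => //.
  near=> t.
  have t0 : 0 < t by near: t; exact: nbhs_left_gt.
  have ta : t < a by near: t; exact: nbhs_left_lt.
  suff : K (z t) by rewrite KE => -[].
  apply: inK.
    apply/unit_sphereP; rewrite /z !(dotvDl, dotvDr, dotvZl, dotvZr) e1 v1.
    by rewrite (dotvC v e) ev; have := cos2Dsin2 t; lra.
  rewrite /z dotvDr !dotvZr e1 ev mulr0 addr0 mulr1 cosK// in_itv/=; lra.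
apply: cvg_at_left_filter; apply: cvgD; apply: cvgZr_tmp.
  exact: continuous_cos.
exact: continuous_sin.
Unshelve. all: by end_near.
Qed.

(** The combination [z = f *: e + g *: y] satisfies [dotv (x - e) z = - f * g + g * f = 0]. Its
    coefficients are nonnegative, so it stays in the cone; it is nonzero because [g > 0] and [K]
    lies in the hemisphere about [e]. *)
Lemma bisector_hits_far e K x y : Sd e -> centered_body e K -> Sd x -> x != e ->
  K y -> dotv y e <= dotv y x -> bisector_hits e K x.
Proof.
move=> Se [[C [CC _ KE]] Ke KB] Sx xe Ky yex.
have /unit_sphereP e1 := Se; have /unit_sphereP x1 := Sx.
have pi0 := @pi_gt0 R.
have [Sy ey] : Sd y /\ 0 <= dotv e y.
  by have /(geodesic_ballP Se)[|Sy] := KB _ Ky; [lra|rewrite cos_pihalf].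
have /unit_sphereP y1 := Sy.
have ex1 : dotv e x < 1.
  have := dotv_ge0 (x - e); rewrite le_eqVlt => /predU1P[/esym/eqP|].
    by rewrite dotv_eq0 subr_eq0 (negPf xe).
  by rewrite !(dotvBl, dotvBr) x1 e1 (dotvC x e); lra.
pose f := dotv y x - dotv y e; pose g := 1 - dotv e x.
have f0 : 0 <= f by rewrite subr_ge0.
have g0 : 0 < g by rewrite subr_gt0.
pose z := f *: e + g *: y.
have [_ _ _ sC] := CC.
have Cz : C z.
  apply: cone_add => //; apply: sC => //; first by move: Ke; rewrite KE => -[].
    exact: ltW.
  by move: Ky; rewrite KE => -[].
have zz : 0 < dotv z z.
  have fge : 0 <= f * g * dotv e y by rewrite !mulr_ge0// ltW.
  have := mulr_gt0 g0 g0; have := mulr_ge0 f0 f0.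
  rewrite /z !(dotvDl, dotvDr, dotvZl, dotvZr) e1 y1 (dotvC y e).
  clearbody f g; lra.
have N0 : 0 < enorm z by rewrite sqrtr_gt0.
exists (normalize z); split.
  rewrite /orthogonal_space/normalize/= dotvZr /z dotvDr !dotvZr !dotvBl e1.
  rewrite (dotvC x y) (dotvC e y) (dotvC x e) -/f -(opprB 1) -/g; ring.
rewrite KE; split; last by apply: sC => //; rewrite invr_ge0 ltW.
apply/unit_sphereP; rewrite /normalize dotvZl dotvZr -enorm_sqr.
by field; rewrite gt_eqF.
Qed.

Lemma circumradius_far_point e K r : Sd e -> centered_body e K ->
  0 <= r < circumradius e K -> exists2 y, K y & r < acos (dotv e y).
Proof.
move=> Se [_ Ke KB]; rewrite /circumradius; set S := [set r | _] => /andP[r0 rS].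
apply: contrapT => H.
have : S r.
  split => // y Ky; have [Sy _] := KB _ Ky; split => //.
  by rewrite leNgt; apply/negP => yr; apply: H; exists y.
move=> Sr; move: rS; apply/negP; rewrite -leNgt.
by apply: ge_inf => //; exists 0 => s [].
Qed.

Lemma circumradius_le_pihalf e K : centered_body e K ->
  circumradius e K <= pi / 2.
Proof.
move=> [_ _ KB]; apply: ge_inf; first by exists 0 => s [].
by split => //; rewrite divr_ge0// pi_ge0.
Qed.

End sphere_geometry.

(** * Lower bounds for the functional by measures of regions *)

Section functional_bounds.
Context {R : realType}.

(* Unlike [ge0_le_integral], no measurability is needed. *)
Lemma ge0_le_integral_sup d0 (T : measurableType d0)
    (mu : {measure set T -> \bar R}) (D : set T) (f g : T -> \bar R) :
  (forall x, 0 <= f x)%E -> (forall x, D x -> f x <= g x)%E ->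
  (\int[mu]_(x in D) f x <= \int[mu]_(x in D) g x)%E.
Proof.
move=> f0 fg.
have fgD x : ((f \_ D) x <= (g \_ D) x)%E.
  by rewrite !patchE; case: ifPn => // /set_mem /fg.
have fD0 x : (0 <= (f \_ D) x)%E by rewrite patchE; case: ifPn.
rewrite integral_mkcond [leRHS]integral_mkcond !ge0_integralTE//; last first.
  by move=> x; exact: le_trans (fgD x).
by apply: le_ereal_sup => _ [h hf <-]; exists h => // x; exact: le_trans (fgD x).
Qed.

Context {d : nat}.
Local Notation vec := 'rV[R]_d.+1.
Local Notation Sd := (unit_sphere R d.+1).
Implicit Types (e x y : vec) (K M : set vec) (a r c : R).

Lemma measurable_dotv_le y c : measurable [set x : vec | c <= dotv y x].
Proof.
have my : measurable_fun setT (fun x => dotv y x : measurableTypeR R).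
  exact: measurable_dotv.
rewrite (_ : [set _ | _] = (dotv y : _ -> measurableTypeR R) @^-1` `[c, +oo[).
  rewrite -[X in measurable X]setTI.
  by apply: my => //; exact: measurable_itv.
by apply/seteqP; split => x /=; rewrite in_itv/= andbT.
Qed.

Lemma measurable_unit_sphere : measurable Sd.
Proof.
rewrite (_ : Sd = (@enorm R d.+1 : _ -> measurableTypeR R) @^-1` [set 1]) //.
rewrite -[X in measurable X]setTI.
by apply: (@measurable_enorm R d.+1) => //; exact: measurable_set1.
Qed.

Lemma measurable_geodesic_ball e r : Sd e -> 0 <= r <= pi ->
  measurable (geodesic_ball e r).
Proof.
move=> Se r0; rewrite (_ : geodesic_ball e r = Sd `&` [set x | cos r <= dotv e x]).
  by apply: measurableI; [exact: measurable_unit_sphere|exact: measurable_dotv_le].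
by apply/seteqP; split => x /(geodesic_ballP Se r0).
Qed.

Lemma le_U_functional e K M : measurable M -> M `<=` Sd `&` bisector_hits e K ->
  (sphere_measure M <= U_functional e K)%E.
Proof.
move=> mM MG.
rewrite -(setIidl (fun x (Mx : M x) => (MG x Mx).1 : Sd x)).
rewrite -integral_indic//; last exact: measurable_unit_sphere.
apply: ge0_le_integral_sup => x; first by rewrite lee_fin.
move=> _; rewrite lee_fin !indicE.
case: (boolP (x \in M)) => // /set_mem /MG[_ xG].
by rewrite mem_set.
Qed.

Lemma U_functional_geodesic_ball e a : Sd e -> 0 < a < pi / 2 ->
  U_functional e (geodesic_ball e a) = sphere_measure (geodesic_ball e (2 * a)).
Proof.
move=> Se a0; have mB : measurable (geodesic_ball e (2 * a)).
  by apply: measurable_geodesic_ball => //; lra.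
have BS : geodesic_ball e (2 * a) `<=` Sd by move=> x [].
rewrite -[in RHS](setIidl BS) -integral_indic//; last exact: measurable_unit_sphere.
apply: eq_integral => x /set_mem Sx; congr EFin.
rewrite -(bisector_hits_ball _ _ Se a0) !indicE; congr (_%:R).
by rewrite in_setI (mem_set Sx).
Qed.

Lemma geodesic_ball_sub_hits e K a : Sd e -> 0 < a < pi / 2 ->
  centered_body e K -> a <= inradius e K ->
  geodesic_ball e (2 * a) `<=` Sd `&` bisector_hits e K.
Proof.
move=> Se a0 [KC _ _] aK; rewrite -(bisector_hits_ball _ _ Se a0).
move=> x [Sx [y [xy yB]]]; split => //; exists y; split => //.
exact: (sub_inradius_ball _ _ _ Se KC a0 aK).
Qed.

(** In terms of cosines, the ball about [y] through [e] with the ball of radius [2 * a] about [e]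
    removed. *)
Definition far_region e y a : set vec :=
  [set x | [/\ Sd x, dotv y e <= dotv y x & dotv e x < cos (2 * a)]].

Lemma measurable_far_region e y a : measurable (far_region e y a).
Proof.
rewrite (_ : far_region e y a = Sd `&` ([set x | dotv y e <= dotv y x] `&`
   ~` [set x | cos (2 * a) <= dotv e x])).
  apply: measurableI; first exact: measurable_unit_sphere.
  apply: measurableI; first exact: measurable_dotv_le.
  by apply: measurableC; exact: measurable_dotv_le.
apply/seteqP; split => x; rewrite /far_region/=.
  by move=> [? ? H]; split => //; split => //; apply/negP; rewrite -ltNge.
by move=> [? [? /negP]]; rewrite -ltNge.
Qed.

Lemma far_region_sub_hits e K y a : Sd e -> centered_body e K -> K y ->
  far_region e y a `<=` Sd `&` bisector_hits e K.
Proof.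
move=> Se KC Ky x [Sx yx xa]; split => //; apply: (bisector_hits_far e K x y) => //.
apply/negP => /eqP xe; move: xa; have /unit_sphereP e1 := Se.
by rewrite xe e1 ltNge cos_le1.
Qed.

(** Both regions consist of points whose bisector hits [K], and they are separated by the value of
    [dotv e x], so their measures add. *)
Lemma le_U_functional_add e K y a : Sd e -> 0 < a < pi / 2 ->
  centered_body e K -> a <= inradius e K -> K y ->
  (sphere_measure (geodesic_ball e (2 * a)) + sphere_measure (far_region e y a)
    <= U_functional e K)%E.
Proof.
move=> Se a0 KC aK Ky.
have mB : measurable (geodesic_ball e (2 * a)).
  by apply: measurable_geodesic_ball => //; lra.
have mE := measurable_far_region e y a.
rewrite -measureU//; last first.
  apply/seteqP; split => x // -[/(geodesic_ballP Se) xB [_ _ xE]].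
  have [|_] := xB; first by lra.
  by rewrite leNgt xE.
apply: le_U_functional; first exact: measurableU.
rewrite subUset; split; last exact: far_region_sub_hits.
exact: geodesic_ball_sub_hits.
Qed.

End functional_bounds.

(** * Boxes around and inside the cones over spherical regions *)

Section cone_volumes.
Context {R : realType} {n : nat}.
Local Notation vec := 'rV[R]_n.+2.
Local Notation Sd := (unit_sphere R n.+2).
Local Notation cone A := (@normalize R n.+2 @^-1` A `&` unit_ball R n.+2).
Implicit Types (e x y v : vec) (a r : R).

Lemma plane_pythagoras e v x (cs sn : R) :
  dotv e e = 1 -> dotv v v = 1 -> dotv e v = 0 -> cs ^+ 2 + sn ^+ 2 = 1 ->
  dotv x (cs *: e + sn *: v) ^+ 2 + dotv x (cs *: v - sn *: e) ^+ 2 =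
  dotv x e ^+ 2 + dotv x v ^+ 2.
Proof.
move=> e1 v1 ev cs1; rewrite !(dotvDr, dotvNr, dotvZr).
transitivity ((cs ^+ 2 + sn ^+ 2) * (dotv x e ^+ 2 + dotv x v ^+ 2)); first by ring.
by rewrite cs1 mul1r.
Qed.

Lemma bessel e v x : dotv e e = 1 -> dotv v v = 1 -> dotv e v = 0 ->
  dotv x e ^+ 2 + dotv x v ^+ 2 <= dotv x x.
Proof.
move=> e1 v1 ev; have := dotv_ge0 (x - dotv x e *: e - dotv x v *: v).
rewrite !(dotvDl, dotvDr, dotvNl, dotvNr, dotvZl, dotvZr) e1 v1.
rewrite (dotvC v e) ev (dotvC e x) (dotvC v x); lra.
Qed.

(** As [0^-1 = 0], the origin normalizes to itself, off the sphere. *)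
Lemma normalize_sphere x : Sd (normalize x) -> 0 < enorm x.
Proof.
move=> /unit_sphereP; rewrite /normalize dotvZl dotvZr => H.
rewrite lt_neqAle enorm_ge0 andbT eq_sym; apply/eqP => N0.
by move: H; rewrite N0 invr0 !mul0r => /esym/eqP; rewrite oner_eq0.
Qed.

(** A unit vector at angle [t <= 2 * a] from [e] has component at most [sin t <= t] along the
    orthogonal direction [v], and points of the cone in the unit ball are shorter. *)
Lemma cone_geodesic_ball_sub e v a : 0 < a < pi / 2 ->
  dotv e e = 1 -> dotv v v = 1 -> dotv e v = 0 ->
  cone (geodesic_ball e (2 * a)) `<=` frame_box e v `[-1, 1] `[- (2 * a), 2 * a] 1.
Proof.
move=> /andP[a0 a1] e1 v1 ev x [/= [Sx xa] x1].
have Se : Sd e by apply/unit_sphereP.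
have Nx := normalize_sphere x Sx.
have exI := dotv_unit_itv Se Sx.
have t0 := acos_ge0 exI.
have sx : `|dotv (normalize x) v| <= 2 * a.
  apply: le_trans xa; rewrite -(@ler_pXn2r _ 2)// ?nnegrE// real_normK ?num_real//.
  have /unit_sphereP nn := Sx.
  have := bessel e v (normalize x) e1 v1 ev.
  rewrite nn (dotvC _ e) -{1}(@acosK R (dotv e (normalize x))) ?in_itv//.
  move: (acos _) t0 => t t0.
  have st : sin t ^+ 2 <= t ^+ 2.
    rewrite -(real_normK (num_real (sin t))) ler_pXn2r ?nnegrE//.
    have [tp|tp] := leP t pi.
      by rewrite ger0_norm ?sin_ge0_pi ?t0//; exact: sin_le_id.
    apply: le_trans (sin_max t) _; have := @pi_ge2 R; lra.
  have := cos2Dsin2 t; lra.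
have xE w : dotv x w = enorm x * dotv (normalize x) w.
  by rewrite /normalize dotvZl mulrA divff ?mul1r// gt_eqF.
have xx1 : dotv x x <= 1 by rewrite -enorm_sqr expr_le1// enorm_ge0.
have be := bessel e v x e1 v1 ev.
split.
- rewrite /= in_itv/= -ler_norml -(@ler_pXn2r _ 2)// ?nnegrE// expr1n.
  by rewrite real_normK ?num_real//; have := sqr_ge0 (dotv x v); lra.
- rewrite /= in_itv/= -ler_norml xE normrM ger0_norm ?enorm_ge0//.
  by apply: le_trans sx; rewrite ler_piMl.
- have := sqr_ge0 (dotv x v); have := sqr_ge0 (dotv x e); lra.
Qed.

Lemma frame_box_sub_cone_far e v (beta a eps : R) :
  dotv e e = 1 -> dotv v v = 1 -> dotv e v = 0 ->
  0 < a -> 0 < eps <= 1 -> a + eps <= pi / 2 ->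
  a + 3 / 4 * eps <= beta <= pi / 2 ->
  frame_box
    (cos (2 * a + 3 / 4 * eps) *: e + sin (2 * a + 3 / 4 * eps) *: v)
    (cos (2 * a + 3 / 4 * eps) *: v - sin (2 * a + 3 / 4 * eps) *: e)
    `[1 / 2, 9 / 10] `[- (3 / 4 * eps / 16), 3 / 4 * eps / 16]
    (Num.sqrt eps * Num.min a (pi / 2 - a) / 5) `<=`
  cone (far_region e (cos beta *: e + sin beta *: v) a).
Proof.
move=> e1 v1 ev a0 eps01 aep /andP[bl bu] x.
have /andP[eps0 eps1] := eps01.
set h := 3 / 4 * eps; set th := 2 * a + h.
set p := (X in frame_box X); set q := (X in frame_box _ X).
rewrite /frame_box/= !in_itv/= => -[tB sB rB].
have pyth := plane_pythagoras e v x (cos th) (sin th) e1 v1 ev (cos2Dsin2 th).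
rewrite -/p -/q in pyth.
have be := bessel e v x e1 v1 ev.
have N2 := enorm_sqr x; have N0 := enorm_ge0 x.
have rE : (Num.sqrt eps * Num.min a (pi / 2 - a) / 5) ^+ 2 =
    eps * Num.min a (pi / 2 - a) ^+ 2 / 25.
  by rewrite !exprMn sqr_sqrtr ?ltW//; field.
have [] := @box_angle_bounds R a eps h _ (dotv x p) (dotv x q) (enorm x) a0
  eps01 aep erefl erefl tB _ N0 _ _.
- by rewrite ler_norml.
- by rewrite N2 pyth.
- by rewrite N2 -rE.
have pi0 := @pi_gt0 R.
have hE : h = 3 / 4 * eps by [].
have c2 := cos2Dsin2 th.
have xp : dotv x p = cos th * dotv x e + sin th * dotv x v.
  by rewrite /p dotvDr !dotvZr.
have xq : dotv x q = cos th * dotv x v - sin th * dotv x e.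
  by rewrite /q dotvDr dotvNr !dotvZr.
have xe : dotv x p * cos th - dotv x q * sin th = dotv x e.
  transitivity ((cos th ^+ 2 + sin th ^+ 2) * dotv x e).
    by rewrite xp xq; ring.
  by rewrite c2 mul1r.
have xv : dotv x p * sin th + dotv x q * cos th = dotv x v.
  transitivity ((cos th ^+ 2 + sin th ^+ 2) * dotv x v).
    by rewrite xp xq; ring.
  by rewrite c2 mul1r.
rewrite xe => N1 H1.
(* The direction at angle [a + h] lies at angle [a] from [p]; rotating back expresses the product
   with it through [e] and [v]. *)
have -> : dotv x p * cos a - dotv x q * sin a =
    dotv x e * cos (a + h) + dotv x v * sin (a + h).
  have aE : a = th - (a + h) by rewrite /th; ring.
  rewrite [in LHS]aE cosB sinB -xe -xv; ring.
move=> H2.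
have Npos : 0 < enorm x.
  rewrite lt_neqAle N0 andbT eq_sym; apply/eqP => Nz.
  have /eqP : dotv x x = 0 by rewrite -N2 Nz expr0n.
  rewrite dotv_eq0 => /eqP xz; move: tB; rewrite xz dotv0l => /andP[]; lra.
have xeN : dotv x e <= enorm x.
  have [xe0|/ltW xe0] := leP (dotv x e) 0; first exact: le_trans N0.
  rewrite -(@ler_pXn2r _ 2)// N2.
  by have := sqr_ge0 (dotv x v); lra.
have sb0 : 0 < sin (a + h) by apply: sin_gt0_pi; lra.
have cb : cos beta <= cos (a + h) by apply: le_cos_pi; lra.
have sb : sin (a + h) <= sin beta by apply: sin_ge_between; lra.
have cb0 : 0 <= cos (a + h) by apply: cos_ge0_pihalf; lra.
(* Passing from [a + h] to [beta] lowers the cosine, which multiplies [enorm x - dotv x e >= 0], and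
   raises the sine, which multiplies [dotv x v >= 0]; the inequality [H2] survives. *)
have key : enorm x * cos beta <= dotv x e * cos beta + dotv x v * sin beta.
  have xsb : 0 <= dotv x v * sin (a + h) by nra.
  have xv0 : 0 <= dotv x v by rewrite -(pmulr_lge0 _ sb0).
  nra.
split; last exact: N1.
rewrite /far_region/=; split.
- apply/unit_sphereP; rewrite /normalize dotvZl dotvZr -N2.
  by field; rewrite gt_eqF.
- rewrite /normalize dotvZr [leRHS]mulrC ler_pdivlMr// !dotvDl !dotvZl e1.
  by rewrite (dotvC v e) ev (dotvC e x) (dotvC v x); lra.
- by rewrite /normalize dotvZr mulrC ltr_pdivrMr// dotvC mulrC.
Qed.

End cone_volumes.

(** * Comparison of the two volumes and the explicit constant *)

Section volume_comparison.
Context {R : realType} {n : nat}.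
Implicit Types (e v : 'rV[R]_n.+2) (a eps beta : R).

Lemma lebesgue_measure_cc (b c : R) : b <= c ->
  lebesgue_measure (`[b, c]%classic : set (measurableTypeR R)) = (c - b)%:E.
Proof.
rewrite (@lebesgue_measure_itv R `[b, c]) /= lte_fin le_eqVlt => /predU1P[->|->//].
by rewrite ltxx subrr.
Qed.

Lemma le_sphere_measure_cone (A C : set 'rV[R]_n.+2) : measurable A ->
  measurable C ->
  @normalize R n.+2 @^-1` A `&` unit_ball R n.+2 `<=` C ->
  (sphere_measure A <= ((fine (lebesgue_rV R n.+2 (unit_ball R n.+2)))^-1)%:E *
    lebesgue_rV R n.+2 C)%E.
Proof.
move=> mA mC AC; apply: lee_wpmul2l; first by rewrite lee_fin invr_ge0 fine_ge0.
apply: le_measure; rewrite ?inE//; apply: measurableI; last exact: measurable_unit_ball.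
by rewrite -[X in measurable X]setTI; exact: measurable_normalize.
Qed.

Lemma ge_sphere_measure_cone (A C : set 'rV[R]_n.+2) : measurable A ->
  measurable C ->
  C `<=` @normalize R n.+2 @^-1` A `&` unit_ball R n.+2 ->
  (((fine (lebesgue_rV R n.+2 (unit_ball R n.+2)))^-1)%:E *
    lebesgue_rV R n.+2 C <= sphere_measure A)%E.
Proof.
move=> mA mC AC; apply: lee_wpmul2l; first by rewrite lee_fin invr_ge0 fine_ge0.
apply: le_measure; rewrite ?inE//; apply: measurableI; last exact: measurable_unit_ball.
by rewrite -[X in measurable X]setTI; exact: measurable_normalize.
Qed.

(* Bounds [2 * pi] below by [6]; for [n = 1] the margin is [40 / 1296 < 3 / 80]. *)
Lemma constant_bound : (0 < n)%N ->
  (2 * pi) ^- (2 * n.+1) * (8 * 5 ^+ n) <= 3 / 80 :> R.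
Proof.
move=> n0; have pi3 := @pi_ge3 R.
have p36 : 36 ^+ n.+1 <= (2 * pi) ^+ (2 * n.+1) :> R.
  by rewrite exprM lerXn2r ?nnegrE ?exprn_ge0//; nra.
have p0 : 0 < (36 : R) ^+ n.+1 by rewrite exprn_gt0.
rewrite mulrC ler_pdivrMr; last exact: lt_le_trans p36.
apply: (@le_trans _ _ (3 / 80 * 36 ^+ n.+1)); last by rewrite ler_wpM2l.
case: n n0 => // k _; rewrite !exprS.
have : (5 : R) ^+ k <= 36 ^+ k by rewrite lerXn2r ?nnegrE//; lra.
have : 0 <= (5 : R) ^+ k by rewrite exprn_ge0.
lra.
Qed.

Lemma far_region_measure_ge e v a eps beta : (0 < n)%N ->
  dotv e e = 1 -> dotv v v = 1 -> dotv e v = 0 ->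
  0 < a < pi / 2 -> 0 < eps <= 1 -> a + eps <= pi / 2 ->
  a + 3 / 4 * eps <= beta <= pi / 2 ->
  (((2 * pi) ^- (2 * n.+1) * a^-1 * Num.min a (pi / 2 - a) ^+ n *
      eps `^ ((n.+1%:R + 1) / 2))%:E * sphere_measure (geodesic_ball e (2 * a)) <=
   sphere_measure (far_region e (cos beta *: e + sin beta *: v) a))%E.
Proof.
move=> n0 e1 v1 ev a0 eps01 aep bb.
have Se : unit_sphere R n.+2 e by apply/unit_sphereP.
have /andP[ap api] := a0; have /andP[ep e1'] := eps01.
have pi3 := @pi_ge3 R.
set m := Num.min a (pi / 2 - a).
have m0 : 0 < m by rewrite lt_min ap subr_gt0.
set c := (X in (X%:E * _)%E).
have ceq : c = (2 * pi) ^- (2 * n.+1) * a^-1 * m ^+ n * (eps * Num.sqrt eps ^+ n).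
  rewrite /c; congr (_ * _).
  (* Here [n.+1] is the dimension of the sphere: the side across the box supplies [eps], and its
     n-dimensional ball factor [Num.sqrt eps ^+ n]. *)
  have -> : (n.+1%:R + 1) / 2 = 1 + 2^-1 * n%:R :> R by rewrite -addn1 natrD; field.
  rewrite powRD ?gt_eqF ?implybT// powRr1 ?ltW// powRrM powR12_sqrt ?ltW//.
  by rewrite powR_mulrn// sqrtr_ge0.
have s0 : 0 < Num.sqrt eps by rewrite sqrtr_gt0.
have c0 : 0 <= c.
  by rewrite ceq !mulr_ge0 ?invr_ge0 ?exprn_ge0 ?mulr_ge0 ?ltW ?pi_gt0//; lra.
set th := 2 * a + 3 / 4 * eps.
set p := cos th *: e + sin th *: v; set q := cos th *: v - sin th *: e.
have ve : dotv v e = 0 by rewrite dotvC.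
have c2 := cos2Dsin2 th.
have pp : dotv p p = 1.
  rewrite /p !(dotvDl, dotvDr, dotvZl, dotvZr) e1 v1 ev ve; lra.
have qq : dotv q q = 1.
  rewrite /q !(dotvDl, dotvDr, dotvNl, dotvNr, dotvZl, dotvZr) e1 v1 ev ve; lra.
have pq : dotv p q = 0.
  by rewrite /p/q !(dotvDl, dotvDr, dotvNl, dotvNr, dotvZl, dotvZr) e1 v1 ev ve; ring.
have [k k0 kE] := @lebesgue_rV_ball_pos R n.
have mitv (b1 b2 : R) : measurable (`[b1, b2]%classic : set (measurableTypeR R)).
  exact: measurable_itv.
set r := Num.sqrt eps * m / 5.
have r0 : 0 < r by rewrite divr_gt0// mulr_gt0.
set h := 3 / 4 * eps / 16.
have h0 : 0 < h by rewrite /h; lra.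
have far := @frame_box_sub_cone_far R n e v beta a eps e1 v1 ev ap eps01 aep bb.
rewrite -/th -/p -/q -/m -/r -/h in far.
apply: (le_trans _ (ge_sphere_measure_cone _ _ (measurable_far_region _ _ _)
  (measurable_frame_box _ _ _ _ _ (mitv _ _) (mitv _ _)) far)).
rewrite lebesgue_frame_box ?(ltW r0)//.
rewrite lebesgue_rV_ballZ// kE !lebesgue_measure_cc; [|lra|lra].
have ball_le := le_sphere_measure_cone _ _ (measurable_geodesic_ball e (2 * a) Se _)
  (measurable_frame_box _ _ _ _ _ (mitv _ _) (mitv _ _))
  (cone_geodesic_ball_sub e v a a0 e1 v1 ev).
apply: le_trans (lee_wpmul2l _ (ball_le _)) _; [by rewrite lee_fin|lra|].
rewrite lebesgue_frame_box//.
rewrite -/(unit_ball R n) kE !lebesgue_measure_cc; [|lra|lra].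
rewrite -!EFinM lee_fin mulrCA ler_wpM2l ?invr_ge0 ?fine_ge0//.
have Cn := constant_bound n0.
have -> : r ^+ n = Num.sqrt eps ^+ n * m ^+ n / 5 ^+ n by rewrite /r !exprMn exprVn.
(* [F] collects the common factors. The slab with sides 2 and [4 * a] leaves 8 once [a] cancels; the
   box with sides 2/5 and [3 / 32 * eps] leaves 3/80, and its radius contributes [5 ^+ n]. *)
pose F := m ^+ n * (eps * Num.sqrt eps ^+ n) * k.
have F0 : 0 <= F by rewrite /F !mulr_ge0 ?exprn_ge0 ?ltW.
move: Cn; have : (0 : R) < 5 ^+ n by rewrite exprn_gt0.
move: (5 ^+ n) => w w0 Cn; have wn0 : w != 0 by rewrite gt_eqF.
have -> : c * ((1 - - 1) * ((2 * a - - (2 * a)) * k)) =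
    (2 * pi) ^- (2 * n.+1) * (8 * w) * (F / w).
  by rewrite ceq /F; move: (_ ^- _) => z; field; rewrite wn0 gt_eqF.
have -> : (9 / 10 - 1 / 2) * ((h - - h) * (Num.sqrt eps ^+ n * m ^+ n / w * k)) =
    3 / 80 * (F / w).
  by rewrite /F/h; field.
by rewrite ler_wpM2r// divr_ge0// ltW.
Qed.

End volume_comparison.

Theorem theorem4p10 (R : realType) (d : nat) (a : R)
    (hd : (2 <= d)%N) (ha0 : 0 < a) (ha1 : a < pi / 2) :
  (forall e : 'rV[R]_d.+1, unit_sphere R d.+1 e ->
    U_functional e (geodesic_ball e a) =
      sphere_measure (geodesic_ball e (2 * a)) /\
    forall K : set 'rV[R]_d.+1,
      centered_body e K -> a <= size_functional e K ->
      (U_functional e (geodesic_ball e a) <= U_functional e K)%E) /\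
  exists c : R,
    (2 * pi) ^- (2 * d) * a^-1 * Num.min a (pi / 2 - a) ^+ (d - 1) <= c /\
    forall (e : 'rV[R]_d.+1) (eps : R) (K : set 'rV[R]_d.+1),
      unit_sphere R d.+1 e -> 0 < eps <= 1 ->
      centered_body e K -> a <= size_functional e K ->
      eps <= deviation e K ->
      ((1 + c * eps `^ ((d%:R + 1) / 2))%:E * U_functional e (geodesic_ball e a)
        <= U_functional e K)%E.
Proof.
have a0 : 0 < a < pi / 2 by apply/andP.
split=> [e Se|].
  rewrite U_functional_geodesic_ball//; split => // K KC aK.
  apply: le_U_functional; first by apply: measurable_geodesic_ball => //; lra.
  exact: geodesic_ball_sub_hits.
(* The constant is taken equal to its required lower bound. *)
case: d hd => [//|n] hn; eexists; split; first exact: lexx.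
rewrite subn1 [n.+1.-1]/= => e eps K Se eps01 KC aK dev.
have /andP[ep e1] := eps01.
have Rle := circumradius_le_pihalf e K KC.
move: dev; rewrite /deviation => dev; rewrite /size_functional in aK.
have aep : a + eps <= pi / 2 by lra.
(* The circumradius is at least [a + eps], so the factor 3/4 puts this radius strictly below it and
   some point of [K] lies beyond. *)
have [|y Ky hy] := circumradius_far_point e K (a + 3 / 4 * eps) Se KC.
  by apply/andP; split; lra.
have [_ _ KB] := KC.
have [Sy yb] := KB _ Ky.
have ey1 := dotv_unit_itv Se Sy.
have eyI : dotv e y \in `[-1, 1] by rewrite in_itv.
have [|v [v1 ev yE]] := tangent_decomposition Se Sy.
  have pi0 := @pi_gt0 R.
  rewrite -(acosK eyI) ltr_norml; apply/andP; split.
    by rewrite -cospi ltr_cos// ?in_itv/=; lra.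
  by rewrite -[ltRHS]cos0 ltr_cos// ?in_itv/=; lra.
have /unit_sphereP ee := Se.
have low := @far_region_measure_ge R n e v a eps _ hn ee v1 ev a0 eps01 aep
  (introT andP (conj (ltW hy) yb)).
rewrite -yE in low.
apply: le_trans (le_U_functional_add e K y a Se a0 KC aK Ky).
rewrite U_functional_geodesic_ball// EFinD muleDl//.
  by rewrite mul1e; exact: leeD2l.
by apply: fin_num_measure; apply: measurable_geodesic_ball => //; lra.
Qed.
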